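(* Consider a system $$\dot x=g^0(x,t)+\sum_{k=1}^{m_u}f^k(x,t)\,u_k+\sum_{j=1}^{m_w}g^j(x,t)\,w_j,\qquad y=[h_1(x,t),\dots,h_p(x,t)],$$ (known inputs $u_k$, unknown inputs $w_j$, state $x$ in an $n$-dimensional manifold $\mathcal M$, all vector fields and outputs smooth), which is in canonical form with respect to its unknown inputs, i.e. there are $m_w$ outputs $\widetilde h_1,\dots,\widetilde h_{m_w}$ among $h_1,\dots,h_p$ such that the matrix $(\mathcal L_{g^i}\widetilde h_j)_{i,j=1}^{m_w}$ is invertible; fix such outputs. Let $\mathcal O$ and $\Omega_k$ ($k\ge0$) be the codistributions defined in the context. Then there exists $\widehat k$ such that, for any $k\ge\widehat k$, $\mathcal O\subseteq\Omega_k$. Conversely, for any $k$, $\Omega_k\subseteq\mathcal O$.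
   Context: **Conventions.** $\nabla$ is the differential with respect to $x$; $\mathcal L_f$ is the Lie derivative along $f$ (on scalars $\mathcal L_fh=\nabla h\cdot f$; on covector fields the usual one, so $\mathcal L_f\nabla h=\nabla\mathcal L_fh$). A (co)distribution is the span, over the ring of smooth scalar functions on the open set under consideration, of finitely many (co)vector fields; for a codistribution $\Omega$, $\mathcal L_f\Omega$ is the span of all $\mathcal L_f\omega$, $\omega\in\Omega$. $[g,\phi]=\frac{\partial\phi}{\partial x}g-\frac{\partial g}{\partial x}\phi$. If the system depends explicitly on $t$, then throughout $\mathcal L_{g^0}$ and $\mathcal L_{\widehat g^0}$ stand for $\mathcal L_{g^0}+\frac{\partial}{\partial t}$ and $\mathcal L_{\widehat g^0}+\frac{\partial}{\partial t}$ in the recursions below. **Definitions.** $\mu^i_j=\mathcal L_{g^i}\widetilde h_j$ ($i,j=1,\dots,m_w$), $\mu^0_0=1$, $\mu^i_0=0$, $\mu^0_i$ is the sum of $\frac{\partial\widetilde h_i}{\partial t}$ and the (plain) Lie derivative of $\widetilde h_i$ along $g^0$. $\nu$ is the inverse of $\mu$: $\sum_{\gamma=0}^{m_w}\mu^\alpha_\gamma\nu^\gamma_\beta=\delta^\alpha_\beta$ for $\alpha,\beta=0,\dots,m_w$. $\widehat g^\alpha=\sum_{\beta=0}^{m_w}\nu^\alpha_\beta g^\beta$, $\alpha=0,\dots,m_w$. Autobracket of a vector field $\phi$ along $\alpha\in\{0,\dots,m_w\}$: $[\phi]^\alpha=\sum_{\beta=0}^{m_w}\nu^\alpha_\beta[g^\beta,\phi]+\delta^\alpha_0\frac{\partial\phi}{\partial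 t}$. $[\phi]^{(\alpha_1,\dots,\alpha_m)}$ is obtained by applying autobrackets successively, first along $\alpha_1$ and last along $\alpha_m$ ($m=0$: $\phi$ itself). Integer $s$: smallest integer with $\Omega^g_s=\Omega^g_{s-1}$, where $\Omega^g_0=\mathrm{span}\{\nabla\widetilde h_1,\dots,\nabla\widetilde h_{m_w}\}$, $\Omega^g_k=\Omega^g_{k-1}+\sum_{\beta=0}^{m_w}\mathcal L_{g^\beta}\Omega^g_{k-1}$ (so $s\le n-m_w+1$). Integer $r$: smallest integer with $\Delta_{r+1}=\Delta_r$, where $\Delta_0=\mathrm{span}\{f^1,\dots,f^{m_u}\}$, $\Delta_k=\Delta_{k-1}+\sum_{\beta=0}^{m_w}\mathrm{span}\{[v]^\beta:v\in\Delta_{k-1}\}$ (so $r\le n-1$). Codistribution $$\widetilde{\mathcal O}=\sum_{q=1}^{m_w}\sum_{j=0}^{s+r}\sum_{\alpha_1,\dots,\alpha_j=0}^{m_w}\sum_{i=1}^{m_u}\mathrm{span}\{\nabla\mathcal L_{[f^i]^{(\alpha_1,\dots,\alpha_j)}}\widetilde h_q\}.$$ Codistribution $\mathcal O$: $\mathcal O_0=\widetilde{\mathcal O}+\mathrm{span}\{\nabla h_1,\dots,\nabla h_p\}$, $\mathcal O_{k+1}=\mathcal O_k+\sum_{i=1}^{m_u}\mathcal L_{f^i}\mathcal O_k+\sum_{\beta=0}^{m_w}\mathcal L_{\widehat g^\beta}\mathcal O_k$, and $\mathcal O=\mathcal O_k$ at the smallest $k$ with $\mathcal O_k=\mathcal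 O_{k-1}$ (this $k$ is at most $n-m_w+1$). Codistributions $\Omega_k$: $\Omega_0=\mathrm{span}\{\nabla h_1,\dots,\nabla h_p\}$, $$\Omega_{k+1}=\Omega_k+\sum_{i=1}^{m_u}\mathcal L_{f^i}\Omega_k+\sum_{\beta=0}^{m_w}\mathcal L_{\widehat g^\beta}\Omega_k+\sum_{q=1}^{m_w}\sum_{i=1}^{m_u}\sum_{\alpha_1,\dots,\alpha_k=0}^{m_w}\mathrm{span}\{\mathcal L_{[f^i]^{(\alpha_1,\dots,\alpha_k)}}\nabla\widetilde h_q\}.$$ The recursions are taken to terminate as stated. *)

(* Defs.v *)
From HB Require Import structures.
From mathcomp Require Import all_boot all_order all_algebra.
From mathcomp Require Import all_classical all_reals all_analysis.

Set Implicit Arguments.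
Unset Strict Implicit.
Unset Printing Implicit Defensive.

Import Order.TTheory GRing.Theory Num.Theory.
Import numFieldNormedType.Exports.

Local Open Scope classical_set_scope.
Local Open Scope ring_scope.

(* C^oo on A (meant to be open): every iterated directional derivative exists
   and is again (Frechet) differentiable at every point of A. *)
Definition smooth_on (R : realType) (V W : normedModType R) (A : set V)
    (f : V -> W) : Prop :=
  forall (vs : seq V) (x : V), A x ->
    differentiable (foldr (fun v (g : V -> W) => fun y => 'D_v g y) f vs) x.

(* The atlas is indexed by [chart]; [coord i] is the chart map, defined on
   [dom i], and [param i] its inverse, meaningful on [coord i @` dom i].
   [chart_at p] is a chart around p. *)
Record smooth_manifold (R : realType) (n : nat) := SmoothManifold {
  mcarrier :> topologicalType ;
  mcarrier_hausdorff : hausdorff_space mcarrier ;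
  mcarrier_second_countable : @second_countable mcarrier ;
  chart : Type ;
  dom : chart -> set mcarrier ;
  coord : chart -> mcarrier -> 'rV[R]_n ;
  param : chart -> 'rV[R]_n -> mcarrier ;
  chart_at : mcarrier -> chart ;
  chart_atP : forall p, dom (chart_at p) p ;
  dom_open : forall i, open (dom i) ;
  img_open : forall i, open (coord i @` dom i) ;
  coord_continuous : forall i, {within dom i, continuous (coord i)} ;
  param_continuous : forall i,
    {within coord i @` dom i, continuous (param i)} ;
  coordK : forall i p, dom i p -> param i (coord i p) = p ;
  transition_smooth : forall i j,
    smooth_on (coord i @` (dom i `&` dom j)) (fun y => coord j (param i y))
}.

Section Fields.
Context {R : realType} {n : nat} {M : smooth_manifold R n}.

Definition scalar_field := M -> R -> R.

(* Time-dependent vector and covector fields on M are both given by their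
   components: [X i a p t] is the a-th component, in chart i, at the point p
   (meaningful for p in [dom i]) and time t. *)
Definition tensor_field := chart M -> 'I_n -> M -> R -> R.

(* The partial derivative with respect to the b-th coordinate of chart i. *)
Definition pd (i : chart M) (b : 'I_n) (h : scalar_field) : scalar_field :=
  fun p t => 'D_(delta_mx 0 b) (fun y : 'rV[R]_n => h (param i y) t)
                               (coord i p).

Definition dt (h : scalar_field) : scalar_field := fun p t => derive1 (h p) t.

Definition dtF (X : tensor_field) : tensor_field := fun i a => dt (X i a).

Definition smooth_in_chart (T : set R) (i : chart M) (h : scalar_field) :=
  smooth_on ((coord i @` dom i) `*` T)
    (fun z : 'rV[R]_n * R => h (param i z.1) z.2).

Definition smooth_scalar (T : set R) (h : scalar_field) : Prop :=
  forall i, smooth_in_chart T i h.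

Definition smooth_vector_field (T : set R) (X : tensor_field) : Prop :=
  (forall i a, smooth_in_chart T i (X i a)) /\
  (forall i j b p t, dom i p -> dom j p -> T t ->
    X j b p t = \sum_a pd i a (fun q _ => coord j q 0 b) p t * X i a p t).

Definition scalar_time_independent (T : set R) (h : scalar_field) : Prop :=
  forall p t t', T t -> T t' -> h p t = h p t'.

Definition field_time_independent (T : set R) (X : tensor_field) : Prop :=
  forall i a p t t', dom i p -> T t -> T t' -> X i a p t = X i a p t'.

Definition grad (h : scalar_field) : tensor_field := fun i a => pd i a h.

(* The contraction of a covector field with a vector field; it does not depend
   on the chart in which it is computed. *)
Definition contract (w X : tensor_field) : scalar_field :=
  fun p t => \sum_a w (chart_at p) a p t * X (chart_at p) a p t.

Definition lie_scalar (X : tensor_field) (h : scalar_field) : scalar_field :=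
  contract (grad h) X.

Definition lie_covector (X w : tensor_field) : tensor_field :=
  fun i a p t => \sum_b (pd i b (w i a) p t * X i b p t
                         + w i b p t * pd i a (X i b) p t).

Definition bracket (g phi : tensor_field) : tensor_field :=
  fun i a p t => \sum_b (pd i b (phi i a) p t * g i b p t
                         - pd i b (g i a) p t * phi i b p t).

End Fields.

Arguments scalar_field {R n} M.
Arguments tensor_field {R n} M.

(* [sys_g ord0] is the drift g^0 and [sys_g (lift ord0 j)], j : 'I_m_w, are the
   vector fields multiplying the unknown inputs.  [sys_td] tells whether the
   system is regarded as depending explicitly on time. *)
Record input_output_system (R : realType) (n : nat) (M : smooth_manifold R n)
    (m_u m_w p : nat) := InputOutputSystem {
  sys_T : set R ;
  sys_T_open : open sys_T ;
  sys_T_interval : is_interval sys_T ;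
  sys_g : 'I_m_w.+1 -> tensor_field M ;
  sys_f : 'I_m_u -> tensor_field M ;
  sys_h : 'I_p -> scalar_field M ;
  sys_g_smooth : forall b, smooth_vector_field sys_T (sys_g b) ;
  sys_f_smooth : forall i, smooth_vector_field sys_T (sys_f i) ;
  sys_h_smooth : forall l, smooth_scalar sys_T (sys_h l) ;
  sys_td : bool ;
  sys_time_independent : ~~ sys_td ->
    [/\ forall b, field_time_independent sys_T (sys_g b),
        forall i, field_time_independent sys_T (sys_f i) &
        forall l, scalar_time_independent sys_T (sys_h l)]
}.

Section Codistributions.
Context {R : realType} {n m_u m_w p : nat} {M : smooth_manifold R n}.
Variables (Sys : input_output_system M m_u m_w p) (sel : 'I_m_w -> 'I_p).

Local Notation T := (sys_T Sys).
Local Notation g := (sys_g Sys).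
Local Notation f := (sys_f Sys).
Local Notation h := (sys_h Sys).

(* Smooth functions of (x, t), or of x alone for a time-independent system. *)
Definition scalar_ring (c : scalar_field M) : Prop :=
  smooth_scalar T c /\ (~~ sys_td Sys -> scalar_time_independent T c).

(* The equation is required only where components are meaningful, so that
   values outside chart domains or outside T are irrelevant. *)
Definition span (G : set (tensor_field M)) : set (tensor_field M) :=
  [set w | exists (m : nat) (c : 'I_m -> scalar_field M)
                  (v : 'I_m -> tensor_field M),
    [/\ forall k, scalar_ring (c k), forall k, G (v k) &
        forall i a q t, dom i q -> T t ->
          w i a q t = \sum_(k < m) c k q t * v k i a q t]].

Definition htilde (j : 'I_m_w) : scalar_field M := h (sel j).

Definition canonical_form : Prop :=
  injective sel /\
  forall q t, T t ->
    (\matrix_(i < m_w, j < m_w) lie_scalar (g (lift ord0 i)) (htilde j) q t)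
      \in unitmx.

(* Row index = upper index alpha, column index = lower index. *)
Definition mu_mx (q : M) (t : R) : 'M[R]_m_w.+1 :=
  \matrix_(al, ga)
    if unlift ord0 ga is Some j
    then lie_scalar (g al) (htilde j) q t
         + (if al == ord0 then dt (htilde j) q t else 0)
    else (al == ord0)%:R.

Definition nu_mx (q : M) (t : R) : 'M[R]_m_w.+1 := invmx (mu_mx q t).

Definition ghat (al : 'I_m_w.+1) : tensor_field M :=
  fun i a q t => \sum_be nu_mx q t al be * g be i a q t.

Definition autobracket (phi : tensor_field M) (al : 'I_m_w.+1) :
    tensor_field M :=
  fun i a q t => \sum_be nu_mx q t al be * bracket (g be) phi i a q t
                 + (if al == ord0 then dtF phi i a q t else 0).

Definition autobrackets (phi : tensor_field M) (als : seq 'I_m_w.+1) :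
    tensor_field M := foldl autobracket phi als.

(* Lie derivative of a covector field along the be-th field of a family X
   (g or ghat), with the time derivative added for be = 0.  For a
   time-independent system that term vanishes. *)
Definition lie_t (X : 'I_m_w.+1 -> tensor_field M) (be : 'I_m_w.+1)
    (w : tensor_field M) : tensor_field M :=
  fun i a q t => lie_covector (X be) w i a q t
                 + (if be == ord0 then dtF w i a q t else 0).

(* Sums of (co)distributions are spans of unions. *)

Fixpoint Omega_g (k : nat) : set (tensor_field M) :=
  if k is k'.+1 then
    span (Omega_g k'
          `|` \bigcup_be span [set lie_t g be w | w in Omega_g k'])
  else span [set grad (htilde j) | j in [set: 'I_m_w]].

Fixpoint Delta (k : nat) : set (tensor_field M) :=
  if k is k'.+1 then
    span (Delta k' `|` \bigcup_be span [set autobracket v be | v in Delta k'])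
  else span [set f i | i in [set: 'I_m_u]].

Definition is_smallest (P : nat -> Prop) (k : nat) : Prop :=
  P k /\ forall j, P j -> (k <= j)%N.

Definition is_s : nat -> Prop :=
  is_smallest (fun s => (0 < s)%N /\ Omega_g s = Omega_g s.-1).

Definition is_r : nat -> Prop := is_smallest (fun r => Delta r.+1 = Delta r).

Definition O_tilde (s r : nat) : set (tensor_field M) :=
  span [set w | exists (q : 'I_m_w) (als : seq 'I_m_w.+1) (i : 'I_m_u),
    (size als <= s + r)%N /\
    w = grad (lie_scalar (autobrackets (f i) als) (htilde q))].

Definition span_grad_h : set (tensor_field M) :=
  span [set grad (h l) | l in [set: 'I_p]].

Fixpoint O_seq (s r k : nat) : set (tensor_field M) :=
  if k is k'.+1 then
    span (O_seq s r k'
          `|` \bigcup_i span [set lie_covector (f i) w | w in O_seq s r k']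
          `|` \bigcup_be span [set lie_t ghat be w | w in O_seq s r k'])
  else span (O_tilde s r `|` span_grad_h).

Definition is_O (s r : nat) (O : set (tensor_field M)) : Prop :=
  exists2 k, is_smallest
               (fun k => (0 < k)%N /\ O_seq s r k = O_seq s r k.-1) k
           & O = O_seq s r k.

Fixpoint Omega (k : nat) : set (tensor_field M) :=
  if k is k'.+1 then
    span (Omega k'
          `|` \bigcup_i span [set lie_covector (f i) w | w in Omega k']
          `|` \bigcup_be span [set lie_t ghat be w | w in Omega k']
          `|` span [set w | exists (q : 'I_m_w) (als : seq 'I_m_w.+1)
                                   (i : 'I_m_u),
                size als = k' /\
                w = lie_covector (autobrackets (f i) als)
                                 (grad (htilde q))])
  else span_grad_h.

End Codistributions.

(* Main.v *)
Require Import Defs.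
From mathcomp Require Import all_boot all_order all_algebra.
From mathcomp Require Import all_classical all_reals all_analysis.
From mathcomp Require Import ring.
(* Restores [coord] and [span], which MathComp's vector library shadows. *)
Import Defs.

Set Implicit Arguments.
Unset Strict Implicit.
Unset Printing Implicit Defensive.

Import Order.TTheory GRing.Theory Num.Theory.
Import numFieldNormedType.Exports.

Local Open Scope classical_set_scope.
Local Open Scope ring_scope.

(** Write [X^al] for the autobracket and let the dual operation on covector fields
    be [w^al := \sum_be nu^al_be L_(g^be) w + delta^al_0 dt w].  Then
      [D^al <w, X> = <w^al, X> + <w, X^al>],  [D^al := L_(ghat^al) + delta^al_0 dt],
    and [O] is stable under [D^al] applied to exact covector fields.  For words [a, b]
    put [om_a := (grad htilde_j)^a], [phi_b := (f^i)^b] and [y_(a,b) := <om_a, phi_b>].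
    Since [O] contains [grad y_(0,b)] for [|b| <= s + r], the identity above puts
    [grad y_(a,b)] in [O] as soon as [|a| + |b| <= s + r].

    By the choice of [s], [om_a] with [|a| = s] is a combination [\sum_k c_k om_(a_k)]
    of shorter ones; by the choice of [r], every [phi_b] is a combination of those with
    [|b| <= r].  Differentiating [y_(a,b) = \sum_k c_k y_(a_k,b)] for [|b| <= r] shows
    that [\sum_k y_(a_k,b) grad c_k] is in [O]; this covector field is linear in
    [phi_b], so it is in [O] for all [b].  Hence, for any [b], if [grad y_(a,b)] is in
    [O] for all [|a| < s], then also for [|a| = s], and
    [y_(a,b al) = D^al y_(a,b) - y_(a al,b)] gives the same for the longer word [b al].
    With [a] empty, [O] contains every generator of every [Omega_k].  The other
    inclusion is [grad L_X h = L_X grad h]. *)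

(** * Smooth functions on open sets *)

(** The first-order expansion of [f] at [x] is also one of [g], because the two functions have the
    same germ; uniqueness of the differential then yields differentiability. *)
Lemma near_eq_differentiable (R : realType) (V W : normedModType R)
    (f g : V -> W) (x : V) :
  {near x, f =1 g} -> differentiable f x -> differentiable g x.
Proof.
move=> fg df.
have gE : g \o shift x = cst (g x) + 'd f x +o_ 0 id.
  apply/eqaddoP => _/posnumP[e].
  have /eqaddoP/(_ _ (gt0 e)) := diff_locally df.
  have : \forall h \near 0, f (h + x) = g (h + x).
    by rewrite (near_shift x); near do rewrite /= sub0r subrK//.
  move=> /filterS2; apply => h E.
  rewrite ![(_ - _) h]/= ![(_ + _) h]/= !fctE /=.
  by rewrite -E -(nbhs_singleton fg).
apply/diff_locallyP; rewrite (diff_unique _ gE); last exact: diff_continuous.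
by split=> //; exact: diff_continuous.
Unshelve. all: by end_near. Qed.

(** * Closure properties of smooth functions, by induction on the order *)

Section Smooth.
Context {R : realType} {V : normedModType R}.
Implicit Types (A : set V) (f g : V -> R).

(** A bounded order makes induction possible: the derivative of a product or of an inverse is built
    from other functions, for which one order less is known. Taking all [k] recovers [smooth_on]. *)
Definition smooth_order k A f : Prop :=
  forall (vs : seq V) (x : V), (size vs <= k)%N -> A x ->
    differentiable (foldr (fun v (g : V -> R) => fun y => 'D_v g y) f vs) x.

Lemma smooth_onP A f : smooth_on A f <-> forall k, smooth_order k A f.
Proof.
split=> [sf k vs x _ Ax|sf vs x Ax]; first exact: sf.
exact: (sf (size vs)).
Qed.

(** Splits off the derivative at the end of the list, the one applied to [f] first, so that an
    induction on [k] can pass from [f] to its derivatives. *)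
Lemma smooth_orderS k A f : smooth_order k.+1 A f <->
  (forall x, A x -> differentiable f x) /\
  (forall v, smooth_order k A ('D_v f)).
Proof.
split=> [sf|[df sf] vs x].
  split=> [x Ax|v vs x szvs Ax]; first exact: (sf [::]).
  by have := sf (rcons vs v) x; rewrite size_rcons foldr_rcons; apply.
case/lastP: vs => [|vs v]; first by move=> _; exact: df.
by rewrite size_rcons foldr_rcons => /sf; apply.
Qed.

Lemma smooth_orderW k A f : smooth_order k.+1 A f -> smooth_order k A f.
Proof. by move=> sf vs x szvs; apply: sf; exact: ltnW. Qed.

Lemma smooth_order_diff k A f x : smooth_order k A f -> A x -> differentiable f x.
Proof. by move=> sf Ax; apply: (sf [::]). Qed.

Lemma open_near_eq A f g x : open A -> {in A, f =1 g} -> A x -> {near x, f =1 g}.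
Proof.
move=> oA fg Ax; near=> y; apply: fg; rewrite inE; near: y.
exact: open_nbhs_nbhs.
Unshelve. all: by end_near. Qed.

Lemma eq_derive_on A f g v : open A -> {in A, f =1 g} -> {in A, 'D_v f =1 'D_v g}.
Proof.
by move=> oA fg x /[!inE] Ax; apply: near_eq_derive; exact: open_near_eq fg Ax.
Qed.

Lemma eq_smooth_order k A f g : open A -> {in A, f =1 g} ->
  smooth_order k A f -> smooth_order k A g.
Proof.
move=> oA fg sf vs x szvs Ax.
apply: near_eq_differentiable (sf vs x szvs Ax).
suff {szvs Ax x} h : {in A, foldr (fun v (g : V -> R) => fun y => 'D_v g y) f vs =1
   foldr (fun v (g : V -> R) => fun y => 'D_v g y) g vs}.
  exact: open_near_eq h Ax.
by elim: vs => //= v vs IH; apply: eq_derive_on.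
Qed.

Lemma smooth_order_cst k A (c : R) : smooth_order k A (cst c).
Proof.
elim: k c => [|k IH] c.
  case=> [|v vs] x //= _ _; exact: differentiable_cst.
apply/smooth_orderS; split=> [x _|v]; first exact: differentiable_cst.
by rewrite (_ : 'D_v (cst c) = cst 0)//; apply/funext => x; exact: derive_cst.
Qed.

Lemma smooth_orderD k A f g : open A -> smooth_order k A f -> smooth_order k A g ->
  smooth_order k A (fun x => f x + g x).
Proof.
move=> oA; elim: k f g => [|k IH] f g sf sg.
  case=> [|v vs] x //= _ Ax; apply: differentiableD;
    [exact: smooth_order_diff sf Ax|exact: smooth_order_diff sg Ax].
apply/smooth_orderS; split=> [x Ax|v].
  apply: differentiableD;
    [exact: smooth_order_diff sf Ax|exact: smooth_order_diff sg Ax].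
move: (sf) (sg) => /smooth_orderS[df sDf] /smooth_orderS[dg sDg].
apply: eq_smooth_order (IH _ _ (sDf v) (sDg v)) => // x /[!inE] Ax.
by rewrite -deriveD//; apply: diff_derivable; [exact: df|exact: dg].
Qed.

Lemma smooth_orderM k A f g : open A -> smooth_order k A f -> smooth_order k A g ->
  smooth_order k A (fun x => f x * g x).
Proof.
move=> oA; elim: k f g => [|k IH] f g sf sg.
  case=> [|v vs] x //= _ Ax; apply: differentiableM;
    [exact: smooth_order_diff sf Ax|exact: smooth_order_diff sg Ax].
apply/smooth_orderS; split=> [x Ax|v].
  apply: differentiableM;
    [exact: smooth_order_diff sf Ax|exact: smooth_order_diff sg Ax].
move: (sf) (sg) => /smooth_orderS[df sDf] /smooth_orderS[dg sDg].
apply: (@eq_smooth_order _ _ (fun x => f x * 'D_v g x + g x * 'D_v f x)) => //.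
  move=> x /[!inE] Ax.
  by rewrite [RHS]deriveM//; apply: diff_derivable; [exact: df|exact: dg].
by apply: smooth_orderD => //; apply: IH => //; exact: smooth_orderW.
Qed.

(** The derivative of [1 / f] along [v] is [- (1 / f)^2 * 'D_v f], a product of factors already
    known to have order [k]. *)
Lemma smooth_orderV k A f : open A -> (forall x, A x -> f x != 0) ->
  smooth_order k A f -> smooth_order k A (fun x => (f x)^-1).
Proof.
move=> oA f0; elim: k => [|k IH] sf.
  case=> [|v vs] x //= _ Ax; apply: differentiableV;
    [exact: smooth_order_diff sf Ax|exact: f0].
apply/smooth_orderS; split=> [x Ax|v].
  by apply: differentiableV; [exact: smooth_order_diff sf Ax|exact: f0].
move: (sf) => /smooth_orderS[df sDf].
apply: (@eq_smooth_order _ _ (fun x => (- 1) * ((f x)^-1 * (f x)^-1 * 'D_v f x))) => //.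
  move=> x /[!inE] Ax.
  rewrite [RHS]deriveV ?f0//; last exact/diff_derivable/df.
  by rewrite mulN1r scaleNr expr2 invfM.
apply: smooth_orderM => //; first exact: smooth_order_cst.
have := IH (smooth_orderW sf).
by move=> ?; do 2 apply: smooth_orderM => //.
Qed.

Lemma smooth_on_diff A f x : smooth_on A f -> A x -> differentiable f x.
Proof. by move=> sf Ax; exact: (sf [::]). Qed.

Lemma smooth_on_derive A f v : smooth_on A f -> smooth_on A ('D_v f).
Proof.
by move=> /smooth_onP sf; apply/smooth_onP => k; have /smooth_orderS[] := sf k.+1.
Qed.

Lemma eq_smooth_on A f g : open A -> {in A, f =1 g} -> smooth_on A f -> smooth_on A g.
Proof.
by move=> oA fg /smooth_onP sf; apply/smooth_onP => k; exact: eq_smooth_order fg _.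
Qed.

Lemma smooth_on_cst A (c : R) : smooth_on A (fun=> c).
Proof. by apply/smooth_onP => k; exact: smooth_order_cst. Qed.

Lemma smooth_onD A f g : open A -> smooth_on A f -> smooth_on A g ->
  smooth_on A (fun x => f x + g x).
Proof.
move=> oA /smooth_onP sf /smooth_onP sg; apply/smooth_onP => k.
exact: smooth_orderD.
Qed.

Lemma smooth_onM A f g : open A -> smooth_on A f -> smooth_on A g ->
  smooth_on A (fun x => f x * g x).
Proof.
move=> oA /smooth_onP sf /smooth_onP sg; apply/smooth_onP => k.
exact: smooth_orderM.
Qed.

Lemma smooth_onV A f : open A -> (forall x, A x -> f x != 0) ->
  smooth_on A f -> smooth_on A (fun x => (f x)^-1).
Proof.
move=> oA f0 /smooth_onP sf; apply/smooth_onP => k.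
exact: smooth_orderV.
Qed.

(** * Symmetry of second derivatives *)

Lemma is_derive_line f (x v : V) (s : R) : differentiable f (x + s *: v) ->
  is_derive s 1 (fun s => f (x + s *: v)) ('D_v f (x + s *: v)).
Proof.
move=> df.
have dl : differentiable (fun s : R => x + s *: v) s by [].
have dfl := differentiable_comp dl df.
apply: DeriveDef; first exact: (diff_derivable dfl).
rewrite /derive; set g1 := fun h => h^-1 *: _; set g2 := fun h => h^-1 *: _.
suff -> : g1 = g2 by [].
apply/funext => h; rewrite /g1 /g2 /=.
by rewrite [h%:A]mulr1 scalerDl addrCA.
Qed.

(** The mean value theorem is applied twice: along [u] to the difference of [f] on two opposite
    sides of the parallelogram, then along [v] to ['D_u f]. *)
Lemma mixed_difference A f (x u v : V) (h : R) : 0 <= h ->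
    (forall a b, 0 <= a <= h -> 0 <= b <= h -> A (x + a *: u + b *: v)) ->
    smooth_on A f ->
  exists c d : R, [/\ 0 <= c <= h, 0 <= d <= h &
    f (x + h *: u + h *: v) - f (x + h *: u) - f (x + h *: v) + f x =
    'D_v ('D_u f) (x + c *: u + d *: v) * h * h].
Proof.
move=> h0 hA sf.
have hh : 0 <= h <= h by rewrite h0 lexx.
have h00 : (0 : R) <= 0 <= h by rewrite lexx h0.
have hA0 a : 0 <= a <= h -> A (x + a *: u).
  by move=> ha; have := hA a 0 ha h00; rewrite scale0r addr0.
pose phi (a : R) := f (x + h *: v + a *: u) - f (x + a *: u).
have dphi a : 0 <= a <= h -> is_derive a 1 phi
    ('D_u f (x + h *: v + a *: u) - 'D_u f (x + a *: u)).
  move=> ha; apply: is_deriveB; apply: is_derive_line; apply: smooth_on_diff sf _.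
    by rewrite addrAC; exact: hA.
  exact: hA0.
have itvP (a : R) : a \in `]0, h[%R -> 0 <= a <= h.
  by rewrite in_itv/= => /andP[/ltW-> /ltW->].
have cphi : {within `[0, h], continuous phi}.
  by apply: derivable_within_continuous => a; rewrite in_itv/= => /dphi[].
have [c hc] := MVT_segment h0 (fun a ha => dphi a (itvP a ha)) cphi.
rewrite /phi !scale0r !addr0 subr0 => phiE.
rewrite in_itv/= in hc.
pose psi (b : R) := 'D_u f (x + c *: u + b *: v).
have dpsi b : 0 <= b <= h -> is_derive b 1 psi
    ('D_v ('D_u f) (x + c *: u + b *: v)).
  move=> hb; apply: is_derive_line; apply: smooth_on_diff (hA _ _ hc hb).
  exact: smooth_on_derive.
have cpsi : {within `[0, h], continuous psi}.
  by apply: derivable_within_continuous => a; rewrite in_itv/= => /dpsi[].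
have [d hd] := MVT_segment h0 (fun a ha => dpsi a (itvP a ha)) cpsi.
rewrite /psi !scale0r !addr0 subr0 => psiE.
rewrite in_itv/= in hd.
exists c, d; split => //.
rewrite -psiE [x + c *: u + h *: v]addrAC -phiE.
by rewrite [x + h *: u + h *: v]addrAC; ring.
Qed.

(** [Q h] is meant as the second difference over the parallelogram with sides [h *: u] and [h *: v]:
    dividing by [h * h] equates values of [F1] and [F2] at points that tend to [x] with [h], and
    continuity concludes. *)
Lemma eq_mixed_difference A (F1 F2 : V -> R) (Q : R -> R) (x u v : V) :
    open A -> A x -> {for x, continuous F1} -> {for x, continuous F2} ->
    (forall h, 0 <= h ->
      (forall a b, 0 <= a <= h -> 0 <= b <= h -> A (x + a *: u + b *: v)) ->
      (exists c d, [/\ 0 <= c <= h, 0 <= d <= h &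
         Q h = F1 (x + c *: u + d *: v) * h * h]) /\
      (exists c d, [/\ 0 <= c <= h, 0 <= d <= h &
         Q h = F2 (x + c *: u + d *: v) * h * h])) ->
  F1 x = F2 x.
Proof.
move=> oA Ax cF1 cF2 md.
apply/eqP; rewrite -subr_eq0 -normr_le0; apply/ler_addgt0Pl => e e0.
rewrite addr0.
have e20 : 0 < e / 2 by rewrite divr_gt0.
have /nbhs_ballP[d /= d0 hd] : \forall y \near x,
    [/\ A y, `|F1 x - F1 y| < e / 2 & `|F2 x - F2 y| < e / 2].
  have /cvgrPdist_lt/(_ _ e20) N1 := cF1.
  have /cvgrPdist_lt/(_ _ e20) N2 := cF2.
  have NA : nbhs x A by exact: open_nbhs_nbhs.
  exact: filterS3 NA N1 N2.
(* Small enough for the parallelogram to lie in the ball of radius [d]: the summand 1 keeps the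
   denominator positive when [u] and [v] vanish, and halving makes the inequality strict. *)
pose h := d / (1 + `|u| + `|v|) / 2.
have n0 : 0 < 1 + `|u| + `|v| by rewrite -addrA ltr_wpDr// addr_ge0.
have h0 : 0 < h by rewrite !divr_gt0.
have hball a b : 0 <= a <= h -> 0 <= b <= h -> ball x d (x + a *: u + b *: v).
  move=> /andP[a0 ah] /andP[b0 bh].
  rewrite -ball_normE /= -addrA opprD addrA subrr add0r normrN.
  apply: (@le_lt_trans _ _ (h * (1 + `|u| + `|v|))).
    apply: le_trans (ler_normD _ _) _; rewrite !normrZ !ger0_norm// -addrA mulrDr mulr1.
    apply: ler_wpDl; first exact: ltW.
    by rewrite mulrDr lerD// ler_wpM2r.
  rewrite /h mulrAC divfK ?gt_eqF// ltr_pdivrMr// mulr_natr mulr2n ltrDl//.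
have hA a b : 0 <= a <= h -> 0 <= b <= h -> A (x + a *: u + b *: v).
  by move=> ha hb; have [] := hd _ (hball _ _ ha hb).
have [[c1 [d1 [hc1 hd1 E1]]] [c2 [d2 [hc2 hd2 E2]]]] := md _ (ltW h0) hA.
have E : F1 (x + c1 *: u + d1 *: v) = F2 (x + c2 *: u + d2 *: v).
  by do 2 apply: (mulIf (lt0r_neq0 h0)); rewrite -E1 -E2.
have [_ H1 _] := hd _ (hball _ _ hc1 hd1).
have [_ _ H2] := hd _ (hball _ _ hc2 hd2).
rewrite [X in `|X|](_ : _ = (F1 x - F1 (x + c1 *: u + d1 *: v)) -
   (F2 x - F2 (x + c2 *: u + d2 *: v))); last first.
  by rewrite E opprB addrA subrK.
rewrite [leRHS]splitr; apply: le_trans (ler_normB _ _) _.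
by rewrite lerD// ltW.
Qed.

Lemma derive_comm A f (x u v : V) : open A -> smooth_on A f -> A x ->
  'D_v ('D_u f) x = 'D_u ('D_v f) x.
Proof.
move=> oA sf Ax.
have cD a b : {for x, continuous ('D_a ('D_b f))}.
  apply: differentiable_continuous; apply: smooth_on_diff Ax.
  by do 2 apply: smooth_on_derive.
apply: (eq_mixed_difference oA Ax (cD v u) (cD u v) (u := u) (v := v)) => h h0 hA.
split; first exact: mixed_difference hA sf.
(* The second difference is symmetric in [u] and [v], so exchanging them gives the other mixed
   derivative at a point of the same parallelogram. *)
have hA' a b : 0 <= a <= h -> 0 <= b <= h -> A (x + a *: v + b *: u).
  by move=> ha hb; rewrite addrAC; exact: hA.
have [c [d [hc hd E]]] := mixed_difference h0 hA' sf.
exists d, c; split; [exact: hd|exact: hc|].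
rewrite [x + d *: u + c *: v]addrAC; apply: etrans E.
by rewrite [x + h *: v + h *: u]addrAC; ring.
Qed.

End Smooth.

(** * Calculus in a chart *)

Section ChartCalculus.
Context {R : realType} {n : nat} {M : smooth_manifold R n}.
Variables (T : set R) (oT : open T) (i : chart M).
Implicit Types (c d h : scalar_field M) (q : M) (t : R) (o : option 'I_n).

Local Notation sic := (smooth_in_chart T i).

(** Space and time variables are merged into one vector, so that coordinate and time derivatives are
    both directional derivatives of a single function and share their rules. *)
Definition local_repr h : 'rV[R]_n * R -> R := fun z => h (param i z.1) z.2.

Definition cylinder : set ('rV[R]_n * R) := (coord i @` dom i) `*` T.

Definition eq_on c d : Prop := forall q t, dom i q -> T t -> c q t = d q t.

(* [None] stands for the time direction. *)
Definition direction o : 'rV[R]_n * R :=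
  if o is Some b then (delta_mx 0 b, 0) else (0, 1).

Definition partial o h : scalar_field M := if o is Some b then pd i b h else dt h.

Lemma open_cylinder : open cylinder.
Proof.
rewrite openE => -[y t] [/= Ay Tt].
exists (coord i @` dom i, T) => //; split; apply: open_nbhs_nbhs; split => //.
exact: img_open.
Qed.

Lemma cylinder_coord q t : dom i q -> T t -> cylinder (coord i q, t).
Proof. by move=> iq Tt; split => //=; exists q. Qed.

Lemma eq_on_local c d : eq_on c d -> {in cylinder, local_repr c =1 local_repr d}.
Proof.
move=> cd [y t] /[!inE] -[] /= [q iq <-] Tt.
by rewrite /local_repr /= coordK//; exact: cd.
Qed.

Lemma local_reprE h q t : dom i q -> local_repr h (coord i q, t) = h q t.
Proof. by move=> iq; rewrite /local_repr /= coordK. Qed.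

(** The difference quotients on both sides are the same function, since [direction o] moves only one
    of the two components. *)
Lemma partialE o h q t : dom i q ->
  partial o h q t = 'D_(direction o) (local_repr h) (coord i q, t).
Proof.
move=> iq; case: o => [b|] /=; rewrite ?/pd ?/dt ?derive1E /derive /local_repr.
  set g1 := fun e => e^-1 *: _; set g2 := fun e => e^-1 *: _.
  suff -> : g1 = g2 by [].
  by apply/funext => e; rewrite /g1 /g2 /= scaler0 add0r.
set g1 := fun e => e^-1 *: _; set g2 := fun e => e^-1 *: _.
suff -> : g1 = g2 by [].
by apply/funext => e; rewrite /g1 /g2 /= scaler0 add0r coordK.
Qed.

Lemma local_partial o h :
  {in cylinder, 'D_(direction o) (local_repr h) =1 local_repr (partial o h)}.
Proof.
move=> [y t] /[!inE] -[] /= [q iq <-] Tt.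
by rewrite local_reprE// partialE.
Qed.

Lemma eq_smooth_in_chart c d : eq_on c d -> sic c -> sic d.
Proof.
by move=> /eq_on_local cd; apply: eq_smooth_on => //; exact: open_cylinder.
Qed.

Lemma smooth_in_chart_cst (x : R) : sic (fun _ _ => x).
Proof. exact: smooth_on_cst. Qed.

Lemma smooth_in_chartD c d : sic c -> sic d -> sic (fun q t => c q t + d q t).
Proof. by move=> sc sd; apply: smooth_onD => //; exact: open_cylinder. Qed.

Lemma smooth_in_chartM c d : sic c -> sic d -> sic (fun q t => c q t * d q t).
Proof. by move=> sc sd; apply: smooth_onM => //; exact: open_cylinder. Qed.

Lemma smooth_in_chartN c : sic c -> sic (fun q t => - c q t).
Proof.
move=> sc; apply: (@eq_smooth_in_chart (fun q t => -1 * c q t)).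
  by move=> q t _ _; rewrite mulN1r.
by apply: smooth_in_chartM => //; exact: smooth_in_chart_cst.
Qed.

Lemma smooth_in_chartB c d : sic c -> sic d -> sic (fun q t => c q t - d q t).
Proof. by move=> sc /smooth_in_chartN; exact: smooth_in_chartD. Qed.

Lemma smooth_in_chartV c : (forall q t, dom i q -> T t -> c q t != 0) ->
  sic c -> sic (fun q t => (c q t)^-1).
Proof.
move=> c0 sc; apply: smooth_onV => //; first exact: open_cylinder.
by move=> [y t] -[] /= [q iq <-] Tt; rewrite coordK//; exact: c0.
Qed.

Lemma smooth_in_chart_sum (I : finType) (F : I -> scalar_field M) :
  (forall k, sic (F k)) -> sic (fun q t => \sum_k F k q t).
Proof.
move=> sF; elim: (index_enum I) => [|k r IH].
  by under eq_fun do under eq_fun do rewrite big_nil; exact: smooth_in_chart_cst.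
by under eq_fun do under eq_fun do rewrite big_cons; exact: (smooth_in_chartD (sF k) IH).
Qed.

Lemma smooth_in_chart_prod (I : finType) (F : I -> scalar_field M) :
  (forall k, sic (F k)) -> sic (fun q t => \prod_k F k q t).
Proof.
move=> sF; elim: (index_enum I) => [|k r IH].
  by under eq_fun do under eq_fun do rewrite big_nil; exact: smooth_in_chart_cst.
by under eq_fun do under eq_fun do rewrite big_cons; exact: (smooth_in_chartM (sF k) IH).
Qed.

Lemma smooth_in_chart_partial o h : sic h -> sic (partial o h).
Proof.
move=> sh; apply: eq_smooth_on (@local_partial o h) _; first exact: open_cylinder.
exact: smooth_on_derive.
Qed.

Lemma smooth_in_chart_pd b h : sic h -> sic (pd i b h).
Proof. exact: (@smooth_in_chart_partial (Some b)). Qed.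

Lemma smooth_in_chart_dt h : sic h -> sic (dt h).
Proof. exact: (@smooth_in_chart_partial None). Qed.

Lemma eq_partial o c d : eq_on c d -> eq_on (partial o c) (partial o d).
Proof.
move=> /eq_on_local cd q t iq Tt; rewrite !partialE//.
apply: eq_derive_on cd _ _ => //; first exact: open_cylinder.
by rewrite inE; exact: cylinder_coord.
Qed.

Lemma smooth_in_chart_differentiable h q t : sic h -> dom i q -> T t ->
  differentiable (local_repr h) (coord i q, t).
Proof. by move=> sh iq Tt; apply: smooth_on_diff sh _; exact: cylinder_coord. Qed.

Lemma partial_cst o (x : R) q t : dom i q -> partial o (fun _ _ => x) q t = 0.
Proof. by move=> iq; rewrite partialE//; exact: derive_cst. Qed.

Lemma partialD o c d q t : sic c -> sic d -> dom i q -> T t ->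
  partial o (fun q t => c q t + d q t) q t = partial o c q t + partial o d q t.
Proof.
move=> sc sd iq Tt; rewrite !partialE//.
by apply: deriveD; apply: diff_derivable; exact: smooth_in_chart_differentiable.
Qed.

Lemma partialM o c d q t : sic c -> sic d -> dom i q -> T t ->
  partial o (fun q t => c q t * d q t) q t =
  partial o c q t * d q t + c q t * partial o d q t.
Proof.
move=> sc sd iq Tt; rewrite !partialE//.
rewrite [LHS](@deriveM _ _ (local_repr c) (local_repr d));
  try by apply: diff_derivable; exact: smooth_in_chart_differentiable.
by rewrite !local_reprE// addrC; congr (_ + _); exact: mulrC.
Qed.

Lemma partialN o c q t : sic c -> dom i q -> T t ->
  partial o (fun q t => - c q t) q t = - partial o c q t.
Proof.
move=> sc iq Tt; rewrite !partialE//.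
by apply: deriveN; apply: diff_derivable; exact: smooth_in_chart_differentiable.
Qed.

Lemma partial_sum o (I : finType) (F : I -> scalar_field M) q t :
  (forall k, sic (F k)) -> dom i q -> T t ->
  partial o (fun q t => \sum_k F k q t) q t = \sum_k partial o (F k) q t.
Proof.
move=> sF iq Tt.
suff [_] : sic (fun q t => \sum_k F k q t) /\
    partial o (fun q t => \sum_k F k q t) q t = \sum_k partial o (F k) q t by [].
elim: (index_enum I) => [|k r [IH1 IH2]].
  rewrite big_nil; under eq_fun do under eq_fun do rewrite big_nil.
  by split; [exact: smooth_in_chart_cst|exact: partial_cst].
rewrite big_cons; under eq_fun do under eq_fun do rewrite big_cons.
split; first exact: (smooth_in_chartD (sF k) IH1).
by rewrite partialD// IH2.
Qed.

Lemma partial_comm o o' h : sic h ->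
  eq_on (partial o (partial o' h)) (partial o' (partial o h)).
Proof.
have E (a b : option 'I_n) q t : dom i q -> T t -> partial a (partial b h) q t =
    'D_(direction a) ('D_(direction b) (local_repr h)) (coord i q, t).
  move=> iq Tt; rewrite partialE//; symmetry.
  apply: eq_derive_on (@local_partial b h) _ _; first exact: open_cylinder.
  by rewrite inE; exact: cylinder_coord.
move=> sh q t iq Tt.
apply: etrans (E o o' q t iq Tt) _; apply: etrans (esym (E o' o q t iq Tt)).
by apply: derive_comm sh _; [exact: open_cylinder|exact: cylinder_coord].
Qed.

Lemma eq_pd b c d : eq_on c d -> eq_on (pd i b c) (pd i b d).
Proof. exact: (@eq_partial (Some b)). Qed.

Lemma eq_dt c d : eq_on c d -> eq_on (dt c) (dt d).
Proof. exact: (@eq_partial None). Qed.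

Lemma pdM b c d q t : sic c -> sic d -> dom i q -> T t ->
  pd i b (fun q t => c q t * d q t) q t = pd i b c q t * d q t + c q t * pd i b d q t.
Proof. exact: (@partialM (Some b)). Qed.

Lemma dtM c d q t : sic c -> sic d -> dom i q -> T t ->
  dt (fun q t => c q t * d q t) q t = dt c q t * d q t + c q t * dt d q t.
Proof. exact: (@partialM None). Qed.

Lemma pdD b c d q t : sic c -> sic d -> dom i q -> T t ->
  pd i b (fun q t => c q t + d q t) q t = pd i b c q t + pd i b d q t.
Proof. exact: (@partialD (Some b)). Qed.

Lemma pdN b c q t : sic c -> dom i q -> T t ->
  pd i b (fun q t => - c q t) q t = - pd i b c q t.
Proof. exact: (@partialN (Some b)). Qed.

Lemma pd_sum b (I : finType) (F : I -> scalar_field M) q t :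
  (forall k, sic (F k)) -> dom i q -> T t ->
  pd i b (fun q t => \sum_k F k q t) q t = \sum_k pd i b (F k) q t.
Proof. exact: (@partial_sum (Some b)). Qed.

Lemma dt_sum (I : finType) (F : I -> scalar_field M) q t :
  (forall k, sic (F k)) -> dom i q -> T t ->
  dt (fun q t => \sum_k F k q t) q t = \sum_k dt (F k) q t.
Proof. exact: (@partial_sum None). Qed.

Lemma pd_comm a b h : sic h -> eq_on (pd i a (pd i b h)) (pd i b (pd i a h)).
Proof. exact: (@partial_comm (Some a) (Some b)). Qed.

Lemma dt_pd a h : sic h -> eq_on (dt (pd i a h)) (pd i a (dt h)).
Proof. exact: (@partial_comm None (Some a)). Qed.

(** * Leibniz rules for the pairing of covector and vector fields *)

Definition pairing (w X : tensor_field M) : scalar_field M :=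
  fun q t => \sum_a w i a q t * X i a q t.

Lemma smooth_pairing w X : (forall a, sic (w i a)) -> (forall a, sic (X i a)) ->
  sic (pairing w X).
Proof.
by move=> sw sX; apply: smooth_in_chart_sum => a; exact: smooth_in_chartM.
Qed.

Lemma lie_pairing g w X q t : (forall a, sic (w i a)) -> (forall a, sic (X i a)) ->
    dom i q -> T t ->
  pairing (grad (pairing w X)) g q t =
  pairing (lie_covector g w) X q t + pairing w (bracket g X) q t.
Proof.
move=> sw sX iq Tt.
(* [term] collects the derivatives of [w] and [X]. Those of [g] occur in the Lie derivative as
   [mixed a b] and in the bracket as [- mixed b a]; they cancel in the double sum. *)
pose term a b := pd i b (w i a) q t * X i a q t * g i b q t
  + w i a q t * pd i b (X i a) q t * g i b q t.
pose mixed a b := w i b q t * pd i a (g i b) q t * X i a q t.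
transitivity (\sum_a \sum_b term a b).
  rewrite exchange_big /=; apply: eq_bigr => b _.
  rewrite /grad /pairing pd_sum// ?mulr_suml; last by move=> a; exact: smooth_in_chartM.
  by apply: eq_bigr => a _; rewrite pdM// mulrDl.
transitivity (\sum_a \sum_b (term a b + mixed a b) - \sum_a \sum_b mixed b a).
  apply/eqP; rewrite eq_sym subr_eq; apply/eqP.
  rewrite [X in _ = _ + X]exchange_big -big_split; apply: eq_bigr => a _.
  by rewrite -big_split.
rewrite -sumrB -big_split; apply: eq_bigr => a _ /=.
rewrite mulr_suml mulr_sumr -sumrB -big_split; apply: eq_bigr => b _ /=.
rewrite /term /mixed; ring.
Qed.

Lemma dt_pairing w X q t : (forall a, sic (w i a)) -> (forall a, sic (X i a)) ->
    dom i q -> T t ->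
  dt (pairing w X) q t = pairing (dtF w) X q t + pairing w (dtF X) q t.
Proof.
move=> sw sX iq Tt; rewrite dt_sum//; last by move=> a; exact: smooth_in_chartM.
by rewrite -big_split; apply: eq_bigr => a _ /=; exact: dtM.
Qed.

Lemma grad_pairing X h a q t : sic h -> (forall a, sic (X i a)) ->
    dom i q -> T t ->
  grad (pairing (grad h) X) i a q t = lie_covector X (grad h) i a q t.
Proof.
move=> sh sX iq Tt; rewrite /grad pd_sum//; last first.
  by move=> b; apply: smooth_in_chartM => //; exact: smooth_in_chart_pd.
apply: eq_bigr => b _.
rewrite (pdM a (smooth_in_chart_pd b sh) (sX b) iq Tt).
by rewrite (pd_comm a b sh iq Tt).
Qed.

Lemma smooth_lie_covector g w a : (forall a, sic (g i a)) -> (forall a, sic (w i a)) ->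
  sic (lie_covector g w i a).
Proof.
move=> sg sw; apply: smooth_in_chart_sum => b.
by apply: smooth_in_chartD; apply: smooth_in_chartM => //; exact: smooth_in_chart_pd.
Qed.

Lemma smooth_bracket g X a : (forall a, sic (g i a)) -> (forall a, sic (X i a)) ->
  sic (bracket g X i a).
Proof.
move=> sg sX; apply: smooth_in_chart_sum => b.
by apply: smooth_in_chartB; apply: smooth_in_chartM => //; exact: smooth_in_chart_pd.
Qed.

Lemma lie_covectorM g c w a q t : sic c -> (forall a, sic (w i a)) ->
    dom i q -> T t ->
  lie_covector g (fun j b q t => c q t * w j b q t) i a q t =
  c q t * lie_covector g w i a q t + pairing (grad c) g q t * w i a q t.
Proof.
move=> sc sw iq Tt; rewrite mulr_sumr mulr_suml -big_split; apply: eq_bigr => b _ /=.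
by rewrite pdM// /grad; ring.
Qed.

Lemma bracketM g c X a q t : sic c -> (forall a, sic (X i a)) ->
    dom i q -> T t ->
  bracket g (fun j b q t => c q t * X j b q t) i a q t =
  c q t * bracket g X i a q t + pairing (grad c) g q t * X i a q t.
Proof.
move=> sc sw iq Tt; rewrite mulr_sumr mulr_suml -big_split; apply: eq_bigr => b _ /=.
by rewrite pdM// /grad; ring.
Qed.

Lemma lie_covector_sum (I : finType) g (w : I -> tensor_field M) a q t :
    (forall k a, sic (w k i a)) -> dom i q -> T t ->
  lie_covector g (fun j b q t => \sum_k w k j b q t) i a q t =
  \sum_k lie_covector g (w k) i a q t.
Proof.
move=> sw iq Tt; rewrite exchange_big; apply: eq_bigr => b _ /=.
by rewrite pd_sum// !mulr_suml -big_split.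
Qed.

Lemma bracket_sum (I : finType) g (X : I -> tensor_field M) a q t :
    (forall k a, sic (X k i a)) -> dom i q -> T t ->
  bracket g (fun j b q t => \sum_k X k j b q t) i a q t =
  \sum_k bracket g (X k) i a q t.
Proof.
move=> sw iq Tt; rewrite exchange_big; apply: eq_bigr => b _ /=.
by rewrite pd_sum// mulr_suml mulr_sumr -sumrB.
Qed.

Lemma eq_lie_covector g w w' a : (forall a, eq_on (w i a) (w' i a)) ->
  eq_on (lie_covector g w i a) (lie_covector g w' i a).
Proof.
move=> ww' q t iq Tt; apply: eq_bigr => b _.
by rewrite (eq_pd b (ww' a))// ww'.
Qed.

Lemma eq_bracket g X X' a : (forall a, eq_on (X i a) (X' i a)) ->
  eq_on (bracket g X i a) (bracket g X' i a).
Proof.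
move=> XX' q t iq Tt; apply: eq_bigr => b _.
by rewrite (eq_pd b (XX' a))// XX'.
Qed.

End ChartCalculus.

(** * Chain rule for a change of chart *)

Section ChartChange.
Context {R : realType} {n : nat} {M : smooth_manifold R n}.
Variable T : set R.

Lemma pd_chart_change (i j : chart M) (a : 'I_n) (h : scalar_field M) q t :
    smooth_in_chart T j h -> dom i q -> dom j q -> T t ->
  pd i a h q t =
  \sum_b pd j b h q t * pd i a (fun q _ => coord j q 0 b) q t.
Proof.
move=> sh iq jq Tt; rewrite /pd.
pose tau (y : 'rV[R]_n) : 'rV[R]_n := coord j (param i y).
pose G (y : 'rV[R]_n) : R := h (param j y) t.
have tauq : tau (coord i q) = coord j q by rewrite /tau coordK.
have dtau : differentiable tau (coord i q).
  by apply: (@transition_smooth _ _ _ i j [::]); exists q.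
have dG : differentiable G (coord j q).
  have dpt : differentiable (fun y : 'rV[R]_n => (y, t)) (coord j q).
    exact: differentiable_pair.
  have := smooth_in_chart_differentiable sh jq Tt.
  by move=> /(differentiable_comp dpt).
(* The factorisation through chart [j] is valid only near [coord i q], where [param i] stays in
   [dom j] by continuity. *)
have -> : 'D_(delta_mx 0 a) (fun y : 'rV[R]_n => h (param i y) t) (coord i q) =
          'D_(delta_mx 0 a) (G \o tau) (coord i q).
  apply: near_eq_derive.
  have oi : open (coord i @` dom i) by exact: img_open.
  have icq : (coord i @` dom i) (coord i q) by exists q.
  have := @param_continuous _ _ M i; rewrite continuous_open_subspace//.
  move=> /(_ (coord i q)); rewrite inE => /(_ icq) pcont.
  have jnear : \forall y \near coord i q, dom j (param i y).
    apply: pcont; apply: open_nbhs_nbhs; split; first exact: dom_open.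
    by rewrite coordK.
  by apply: filterS jnear => y jy; rewrite /G /tau /= coordK.
have dGtau : differentiable G (tau (coord i q)) by rewrite tauq.
rewrite (deriveE _ (differentiable_comp dtau dGtau)) (diff_comp dtau dGtau) /=.
rewrite -(deriveE _ dtau) tauq ['D__ tau _]row_sum_delta linear_sum.
apply: eq_bigr => b _.
rewrite linearZ /= -(deriveE _ dG) mulrC; congr (_ * _).
by rewrite (derive_mx (diff_derivable dtau)) mxE.
Qed.

End ChartChange.

(** * Derivatives of time-independent functions *)

Section TimeIndependence.
Context {R : realType} {n : nat} {M : smooth_manifold R n}.
Variables (T : set R) (oT : open T).

Lemma pd_time_independent (i : chart M) (b : 'I_n) (c : scalar_field M) q t t' :
    (forall q t t', dom i q -> T t -> T t' -> c q t = c q t') ->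
    dom i q -> T t -> T t' ->
  pd i b c q t = pd i b c q t'.
Proof.
move=> cti iq Tt Tt'; apply: near_eq_derive.
have oi : open (coord i @` dom i) by exact: img_open.
have inear : nbhs (coord i q) (coord i @` dom i).
  by apply: open_nbhs_nbhs; split => //; exists q.
by apply: filterS inear => _ [q' iq' <-]; rewrite coordK//; exact: cti.
Qed.

Lemma dt_time_independent (c : scalar_field M) q t :
  (forall t t', T t -> T t' -> c q t = c q t') -> T t -> dt c q t = 0.
Proof.
move=> cti Tt; rewrite /dt derive1E -(derive_cst (c q t) t 1).
apply: near_eq_derive.
have Tnear : nbhs t T by exact: open_nbhs_nbhs.
by apply: filterS Tnear => t' Tt'; exact: cti.
Qed.

End TimeIndependence.

(** * Smoothness of determinants and inverse matrices *)

Section MatrixSmoothness.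
Context {R : realType} {n : nat} {M : smooth_manifold R n}.
Variables (T : set R) (oT : open T) (i : chart M).

Lemma smooth_in_chart_det m (A : M -> R -> 'M[R]_m) :
  (forall a b, smooth_in_chart T i (fun q t => A q t a b)) ->
  smooth_in_chart T i (fun q t => \det (A q t)).
Proof.
move=> sA; apply: smooth_in_chart_sum => // s.
apply: smooth_in_chartM => //; first exact: smooth_in_chart_cst.
by apply: smooth_in_chart_prod.
Qed.

Lemma smooth_in_chart_invmx m (A : M -> R -> 'M[R]_m) a b :
  (forall q t, T t -> A q t \in unitmx) ->
  (forall a b, smooth_in_chart T i (fun q t => A q t a b)) ->
  smooth_in_chart T i (fun q t => invmx (A q t) a b).
Proof.
move=> uA sA.
(* Cramer's rule: the entry is a cofactor divided by the determinant, which vanishes at no time of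
   [T]. *)
apply: (@eq_smooth_in_chart _ _ _ _ oT _ (fun q t => (\det (A q t))^-1 *
    ((-1) ^+ (b + a) * \det (row' b (col' a (A q t)))))).
  by move=> q t iq Tt; rewrite /invmx uA// !mxE.
apply: smooth_in_chartM => //.
  apply: smooth_in_chartV => //; last exact: smooth_in_chart_det.
  by move=> q t _ Tt; have := uA q t Tt; rewrite unitmxE unitfE.
apply: smooth_in_chartM => //; first exact: smooth_in_chart_cst.
apply: smooth_in_chart_det => c d.
by under eq_fun do under eq_fun do rewrite !mxE; exact: sA.
Qed.

End MatrixSmoothness.

(** * Vector and covector fields of the system *)

Section System.
Context {R : realType} {n m_u m_w p : nat} {M : smooth_manifold R n}.
Variables (Sys : input_output_system M m_u m_w p) (sel : 'I_m_w -> 'I_p).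
Hypothesis hcan : canonical_form Sys sel.

Local Notation T := (sys_T Sys).
Local Notation g := (sys_g Sys).
Local Notation f := (sys_f Sys).
Local Notation h := (sys_h Sys).
Local Notation htilde := (htilde Sys sel).
Local Notation nu_mx := (nu_mx Sys sel).
Local Notation mu_mx := (mu_mx Sys sel).
Local Notation ghat := (ghat Sys sel).
Local Notation autobracket := (autobracket Sys sel).
Local Notation autobrackets := (autobrackets Sys sel).
Local Notation sring := (scalar_ring Sys).
Local Notation oT := (@sys_T_open _ _ _ _ _ _ Sys).

Implicit Types (c d th : scalar_field M) (X w : tensor_field M) (al be : 'I_m_w.+1).

(* The contraction of [X] with exact covector fields is the only consequence of
   the transformation law of vector fields that is needed, and unlike that law it
   is preserved by brackets for a purely formal reason. *)
Definition vector_field X : Prop :=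
  [/\ forall i a, smooth_in_chart T i (X i a),
      forall c, smooth_scalar T c ->
        forall i, eq_on T i (contract (grad c) X) (pairing i (grad c) X) &
      ~~ sys_td Sys -> field_time_independent T X].

(** Defined by duality: the contractions with vector fields must agree in all charts and lie in the
    ring of coefficients. In this form the Leibniz rule alone shows that [coautobracket] preserves
    the property. *)
Definition covector_field w : Prop :=
  [/\ forall i a, smooth_in_chart T i (w i a),
      forall X, vector_field X ->
        forall i, eq_on T i (contract w X) (pairing i w X) &
      forall X, vector_field X -> scalar_ring Sys (contract w X)].

Lemma vector_field_pairing X :
    (forall i a, smooth_in_chart T i (X i a)) ->
    (~~ sys_td Sys -> field_time_independent T X) ->
    (forall c, smooth_scalar T c ->
       exists k, forall i, eq_on T i (pairing i (grad c) X) k) ->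
  vector_field X.
Proof.
move=> sX tX kX; split => // c /kX[k' kE] i q t iq Tt.
by rewrite kE//; apply: (kE (chart_at q)) => //; exact: chart_atP.
Qed.

(** The Jacobian factors in the transformation law of [X] are those of the chain rule for
    [grad c]. *)
Lemma smooth_vector_field_vector_field X : smooth_vector_field T X ->
  (~~ sys_td Sys -> field_time_independent T X) -> vector_field X.
Proof.
move=> [sX lawX] tX; split => // c sc i q t iq Tt.
have jq := chart_atP q; rewrite /contract; move: (chart_at q) jq => j jq.
transitivity (\sum_b \sum_a pd j b c q t *
    (pd i a (fun q _ => coord j q 0 b) q t * X i a q t)).
  by apply: eq_bigr => b _; rewrite /grad (lawX i j)// mulr_sumr.
rewrite exchange_big; apply: eq_bigr => a _ /=.
rewrite /grad (pd_chart_change a (sc j) iq jq Tt) mulr_suml.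
by apply: eq_bigr => b _; rewrite mulrA.
Qed.

Lemma vector_field_g be : vector_field (g be).
Proof.
apply: smooth_vector_field_vector_field; first exact: sys_g_smooth.
by move=> /(@sys_time_independent _ _ _ _ _ _ Sys)[].
Qed.

Lemma vector_field_f i : vector_field (f i).
Proof.
apply: smooth_vector_field_vector_field; first exact: sys_f_smooth.
by move=> /(@sys_time_independent _ _ _ _ _ _ Sys)[].
Qed.

Lemma scalar_ring_h l : sring (h l).
Proof.
split; first exact: sys_h_smooth.
by move=> /(@sys_time_independent _ _ _ _ _ _ Sys)[].
Qed.

(** * The ring of coefficients *)

Lemma scalar_ring_cst (x : R) : sring (fun _ _ => x).
Proof. by split=> // i; exact: smooth_in_chart_cst. Qed.

Lemma eq_scalar_ring c d : (forall q t, T t -> c q t = d q t) -> sring c -> sring d.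
Proof.
move=> cd [sc tc]; split=> [i|ntd q t t' Tt Tt'].
  by apply: (eq_smooth_in_chart oT _ (sc i)) => q t _; exact: cd.
by rewrite -!cd//; exact: tc.
Qed.

Lemma scalar_ringD c d : sring c -> sring d -> sring (fun q t => c q t + d q t).
Proof.
move=> [sc tc] [sd td]; split=> [i|ntd q t t' Tt Tt'].
  exact: (smooth_in_chartD oT).
by rewrite (tc ntd q t t')// (td ntd q t t').
Qed.

Lemma scalar_ringM c d : sring c -> sring d -> sring (fun q t => c q t * d q t).
Proof.
move=> [sc tc] [sd td]; split=> [i|ntd q t t' Tt Tt'].
  exact: (smooth_in_chartM oT).
by rewrite (tc ntd q t t')// (td ntd q t t').
Qed.

Lemma scalar_ringB c d : sring c -> sring d -> sring (fun q t => c q t - d q t).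
Proof.
move=> rc rd; apply: (@eq_scalar_ring (fun q t => c q t + -1 * d q t)).
  by move=> q t _; rewrite mulN1r.
by apply: scalar_ringD => //; apply: scalar_ringM => //; exact: scalar_ring_cst.
Qed.

Lemma scalar_ring_dt c : sring c -> sring (dt c).
Proof.
move=> [sc tc]; split=> [i|ntd q t t' Tt Tt'].
  exact: (smooth_in_chart_dt oT).
by rewrite !(dt_time_independent oT)// => s s'; exact: tc.
Qed.

Lemma smooth_lie_scalar X c : vector_field X -> smooth_scalar T c ->
  smooth_scalar T (lie_scalar X c).
Proof.
move=> [sX cX _] sc i.
apply: (eq_smooth_in_chart oT (c := pairing i (grad c) X)).
  by move=> q t iq Tt; rewrite -(cX _ sc i q t iq Tt).
by apply: (smooth_pairing oT) => // a; exact: (smooth_in_chart_pd oT).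
Qed.

Lemma scalar_ring_lie X c : vector_field X -> sring c -> sring (lie_scalar X c).
Proof.
move=> vX [sc tc]; split=> [|ntd q t t' Tt Tt']; first exact: smooth_lie_scalar.
have [_ _ /(_ ntd) tX] := vX.
apply: eq_bigr => a _; rewrite (tX _ _ _ t t')//; last exact: chart_atP.
congr (_ * _); apply: (pd_time_independent (T := T)) => //; last exact: chart_atP.
by move=> ? ? ? _; exact: tc.
Qed.

Lemma scalar_ring_htilde j : sring (htilde j).
Proof. exact: scalar_ring_h. Qed.

(** * The matrices [mu] and [nu] *)

Lemma scalar_ring_mu al be : sring (fun q t => mu_mx q t al be).
Proof.
under eq_fun do under eq_fun do rewrite mxE.
case: (unlift _ _) => [j|]; last exact: scalar_ring_cst.
apply: scalar_ringD.
  exact: scalar_ring_lie (vector_field_g _) (scalar_ring_htilde _).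
case: eqP => _; last exact: scalar_ring_cst.
exact/scalar_ring_dt/scalar_ring_htilde.
Qed.

(** The column of index 0 is the first unit vector, and expanding along it leaves the minor that
    [canonical_form] makes invertible. *)
Lemma mu_mx_unit q t : T t -> mu_mx q t \in unitmx.
Proof.
move=> Tt; have := hcan.2 q t Tt; rewrite !unitmxE.
rewrite (expand_det_col (mu_mx q t) ord0) big_ord_recl big1 ?addr0; last first.
  by move=> i _; rewrite mxE unlift_none (eq_sym _ ord0) (negbTE (neq_lift _ _)) mul0r.
rewrite mxE unlift_none eqxx mul1r /cofactor addn0 expr0 mul1r.
set A := (X in \det X \is a _); set B := (X in _ -> \det X \is a _).
suff -> : B = A by [].
apply/matrixP => i j; rewrite !mxE liftK.
by rewrite (eq_sym _ ord0) (negbTE (neq_lift _ _)) addr0.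
Qed.

Lemma scalar_ring_nu al be : sring (fun q t => nu_mx q t al be).
Proof.
split=> [i|ntd q t t' Tt Tt'].
  apply: (smooth_in_chart_invmx oT) => [q t|a b].
    exact: mu_mx_unit.
  exact: (scalar_ring_mu a b).1.
congr (invmx _ _ _); apply/matrixP => a b.
exact: (scalar_ring_mu a b).2.
Qed.

Lemma nu_mu_mx q t al be : T t ->
  \sum_k nu_mx q t al k * mu_mx q t k be = (al == be)%:R.
Proof.
move=> Tt; have := mulVmx (mu_mx_unit q Tt).
by move/matrixP => /(_ al be); rewrite !mxE.
Qed.

Lemma mu_nu_mx q t al be : T t ->
  \sum_k mu_mx q t al k * nu_mx q t k be = (al == be)%:R.
Proof.
move=> Tt; have := mulmxV (mu_mx_unit q Tt).
by move/matrixP => /(_ al be); rewrite !mxE.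
Qed.

Lemma mu_mx_col0 q t al : mu_mx q t al ord0 = (al == ord0)%:R.
Proof. by rewrite mxE unlift_none. Qed.

Lemma nu_mx_col0 q t al : T t -> nu_mx q t al ord0 = (al == ord0)%:R.
Proof.
move=> Tt; rewrite -(nu_mu_mx q al ord0 Tt) (bigD1 ord0)//= mu_mx_col0 eqxx mulr1.
by rewrite big1 ?addr0// => k /negbTE k0; rewrite mu_mx_col0 k0 mulr0.
Qed.

(* Dual to the autobracket in the sense of [lie_t_contract]. *)
Definition coautobracket w al : tensor_field M :=
  fun i a q t => \sum_be nu_mx q t al be * lie_covector (g be) w i a q t
                 + (if al == ord0 then dtF w i a q t else 0).

(** * The derivations D^al on scalars and on exact covector fields *)

Definition lie_t_scalar al c : scalar_field M :=
  fun q t => lie_scalar (ghat al) c q t + (if al == ord0 then dt c q t else 0).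

Lemma lie_scalar_ghat al c q t :
  lie_scalar (ghat al) c q t = \sum_be nu_mx q t al be * lie_scalar (g be) c q t.
Proof.
rewrite /lie_scalar /contract /ghat.
under eq_bigr do rewrite mulr_sumr.
rewrite exchange_big; apply: eq_bigr => be _; rewrite mulr_sumr.
by apply: eq_bigr => a _; rewrite mulrCA.
Qed.

Lemma pairing_ghat al c i q t :
  pairing i (grad c) (ghat al) q t =
  \sum_be nu_mx q t al be * pairing i (grad c) (g be) q t.
Proof.
rewrite /pairing /ghat.
under eq_bigr do rewrite mulr_sumr.
rewrite exchange_big; apply: eq_bigr => be _; rewrite mulr_sumr.
by apply: eq_bigr => a _; rewrite mulrCA.
Qed.

Lemma vector_field_ghat al : vector_field (ghat al).
Proof.
apply: vector_field_pairing => [i a|ntd i a q t t' iq Tt Tt'|c sc].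
- apply: (smooth_in_chart_sum oT) => be.
  apply: (smooth_in_chartM oT).
    exact: (scalar_ring_nu al be).1.
  by have [] := vector_field_g be.
- apply: eq_bigr => be _; rewrite ((scalar_ring_nu al be).2 ntd q t t')//.
  by have [_ _ /(_ ntd i a q t t' iq Tt Tt') ->] := vector_field_g be.
- exists (lie_scalar (ghat al) c) => i q t iq Tt.
  rewrite pairing_ghat lie_scalar_ghat; apply: eq_bigr => be _; congr (_ * _).
  by have [_ cg _] := vector_field_g be; rewrite -(cg _ sc i q t iq Tt).
Qed.

Lemma scalar_ring_lie_t al c : sring c -> sring (lie_t_scalar al c).
Proof.
move=> rc; apply: scalar_ringD; first exact: scalar_ring_lie (vector_field_ghat _) rc.
case: eqP => _; last exact: scalar_ring_cst.
exact: scalar_ring_dt.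
Qed.

Lemma lie_covector_grad X c i a : vector_field X -> smooth_scalar T c ->
  eq_on T i (lie_covector X (grad c) i a) (grad (lie_scalar X c) i a).
Proof.
move=> [sX cX _] sc q t iq Tt.
rewrite -(grad_pairing oT a (sc i) (sX i) iq Tt).
by apply: (eq_pd oT) iq Tt => q' t' iq' Tt'; rewrite -(cX _ sc i q' t' iq' Tt').
Qed.

(** Lie derivatives and the time derivative both commute with the differential. Here [ghat al] is
    differentiated together with its coefficients [nu], unlike in [coautobracket]. *)
Lemma lie_t_ghat_grad al c i a : sring c ->
  eq_on T i (lie_t ghat al (grad c) i a) (grad (lie_t_scalar al c) i a).
Proof.
move=> rc q t iq Tt.
rewrite /lie_t (lie_covector_grad a (vector_field_ghat al) rc.1 iq Tt).
rewrite /grad /dtF /lie_t_scalar.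
rewrite (pdD a (c := lie_scalar (ghat al) c)
           (d := fun q t => if al == ord0 then dt c q t else 0) _ _ iq Tt).
- congr (_ + _); case: eqP => _; first exact: (dt_pd oT a (rc.1 i) iq Tt).
  by apply/esym; exact: (partial_cst (Some a) 0 t iq).
- exact: (scalar_ring_lie (vector_field_ghat al) rc).1.
- case: eqP => _; last exact: smooth_in_chart_cst.
  exact: (smooth_in_chart_dt oT (rc.1 i)).
Qed.

(** * Autobrackets, their duals, and the Leibniz rule that links them *)

Lemma smooth_autobracket X al i a : (forall i a, smooth_in_chart T i (X i a)) ->
  smooth_in_chart T i (autobracket X al i a).
Proof.
move=> sX; apply: (smooth_in_chartD oT).
  apply: (smooth_in_chart_sum oT) => be; apply: (smooth_in_chartM oT).
    exact: (scalar_ring_nu al be).1.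
  by apply: (smooth_bracket oT) => //; have [] := vector_field_g be.
case: eqP => _; last exact: smooth_in_chart_cst.
exact: (smooth_in_chart_dt oT (sX i a)).
Qed.

Lemma smooth_coautobracket w al i a : (forall i a, smooth_in_chart T i (w i a)) ->
  smooth_in_chart T i (coautobracket w al i a).
Proof.
move=> sw; apply: (smooth_in_chartD oT).
  apply: (smooth_in_chart_sum oT) => be; apply: (smooth_in_chartM oT).
    exact: (scalar_ring_nu al be).1.
  by apply: (smooth_lie_covector oT) => //; have [] := vector_field_g be.
case: eqP => _; last exact: smooth_in_chart_cst.
exact: (smooth_in_chart_dt oT (sw i a)).
Qed.

(** Sum of the Leibniz rules along the [g be], weighted by [nu], with the one for the time
    derivative added when [al] is [ord0]. On scalars the Lie derivative along [ghat al] is this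
    weighted sum, so no derivative of [nu] appears. *)
Lemma lie_t_pairing w X th al i :
    (forall i a, smooth_in_chart T i (w i a)) ->
    (forall i a, smooth_in_chart T i (X i a)) ->
    smooth_scalar T th -> eq_on T i th (pairing i w X) ->
  eq_on T i (lie_t_scalar al th)
    (fun q t => pairing i (coautobracket w al) X q t
                + pairing i w (autobracket X al) q t).
Proof.
move=> sw sX sth thE q t iq Tt.
have lieE be : lie_scalar (g be) th q t =
    pairing i (lie_covector (g be) w) X q t + pairing i w (bracket (g be) X) q t.
  have [_ cg _] := vector_field_g be.
  rewrite /lie_scalar (cg _ sth i q t iq Tt).
  rewrite -(lie_pairing oT (g be) (sw i) (sX i) iq Tt).
  by apply: eq_bigr => b _; congr (_ * _); exact: (eq_pd oT b thE iq Tt).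
have dtE : dt th q t = pairing i (dtF w) X q t + pairing i w (dtF X) q t.
  by rewrite (eq_dt oT thE iq Tt) (dt_pairing oT (sw i) (sX i) iq Tt).
rewrite /lie_t_scalar lie_scalar_ghat.
under eq_bigr do rewrite lieE mulrDr.
rewrite big_split /=.
(* Linearity of the pairing in a [nu]-weighted sum with a time term; it serves for the covector and,
   with the factors exchanged, for the vector. *)
have split_co (w' : 'I_m_w.+1 -> 'I_n -> R) (z : 'I_n -> R) (x : 'I_n -> R) :
    \sum_a (\sum_be nu_mx q t al be * w' be a + z a) * x a =
    \sum_be nu_mx q t al be * (\sum_a w' be a * x a) + \sum_a z a * x a.
  under eq_bigr do rewrite mulrDl mulr_suml.
  rewrite big_split exchange_big /=; congr (_ + _); apply: eq_bigr => be _.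
  by rewrite mulr_sumr; apply: eq_bigr => a _; rewrite mulrA.
have -> : pairing i (coautobracket w al) X q t =
    \sum_be nu_mx q t al be * pairing i (lie_covector (g be) w) X q t +
    (if al == ord0 then pairing i (dtF w) X q t else 0).
  rewrite /pairing /coautobracket split_co; congr (_ + _).
  by case: eqP => _ //; rewrite big1// => a _; rewrite mul0r.
have -> : pairing i w (autobracket X al) q t =
    \sum_be nu_mx q t al be * pairing i w (bracket (g be) X) q t +
    (if al == ord0 then pairing i w (dtF X) q t else 0).
  rewrite /pairing /autobracket; under eq_bigr do rewrite mulrC.
  rewrite split_co; congr (_ + _).
    by apply: eq_bigr => be _; congr (_ * _); apply: eq_bigr => a _; rewrite mulrC.
  case: eqP => _ //; first by apply: eq_bigr => a _; rewrite mulrC.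
  by rewrite big1// => a _; rewrite mul0r.
by rewrite [RHS]addrACA dtE; congr (_ + _); case: eqP => _; rewrite ?addr0.
Qed.

(** The Leibniz rule expresses the pairing of [grad c] with the autobracket through derivatives of
    the scalars [c] and [lie_scalar X c]; the resulting scalar, exhibited below, refers to no
    particular chart. *)
Lemma vector_field_autobracket X al :
  vector_field X -> vector_field (autobracket X al).
Proof.
move=> vX; have [sX cX tX] := vX.
apply: vector_field_pairing => [i a|ntd i a q t t' iq Tt Tt'|c sc].
- exact: smooth_autobracket.
- congr (_ + _).
    apply: eq_bigr => be _; rewrite ((scalar_ring_nu al be).2 ntd q t t' Tt Tt').
    have [_ _ /(_ ntd) tg] := vector_field_g be.
    congr (_ * _); apply: eq_bigr => b _; congr (_ * _ - _ * _).
    + by apply: (pd_time_independent (T := T)) => // ? ? ? ? ? ?; exact: (tX ntd).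
    + exact: tg.
    + by apply: (pd_time_independent (T := T)) => // ? ? ? ? ? ?; exact: tg.
    + exact: (tX ntd).
  case: eqP => _ //; rewrite /dtF !(dt_time_independent oT)// => s s' Ts Ts';
    exact: (tX ntd).
- exists (fun q t => lie_t_scalar al (lie_scalar X c) q t -
     (\sum_be nu_mx q t al be * lie_scalar X (lie_scalar (g be) c) q t +
      if al == ord0 then lie_scalar X (dt c) q t else 0)) => i q t iq Tt.
  have sl := smooth_lie_scalar vX sc.
  have sg : forall i a, smooth_in_chart T i (grad c i a).
    by move=> j a; exact: (smooth_in_chart_pd oT a (sc j)).
  apply/eqP; rewrite eq_sym subr_eq; apply/eqP.
  rewrite (lie_t_pairing al sg sX sl (cX c sc i) iq Tt) addrC; congr (_ + _).
  rewrite /pairing /coautobracket.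
  under eq_bigr do rewrite mulrDl mulr_suml.
  rewrite big_split exchange_big /=; congr (_ + _).
    apply: eq_bigr => be _.
    have slg := smooth_lie_scalar (vector_field_g be) sc.
    rewrite /lie_scalar (cX _ slg i q t iq Tt) mulr_sumr; apply: eq_bigr => a _.
    by rewrite -mulrA (lie_covector_grad a (vector_field_g be) sc iq Tt).
  case: eqP => _; last by rewrite big1// => a _; rewrite mul0r.
  have sdt : smooth_scalar T (dt c) by move=> j; exact: (smooth_in_chart_dt oT (sc j)).
  rewrite /lie_scalar (cX _ sdt i q t iq Tt); apply: eq_bigr => a _.
  by rewrite /dtF /grad (dt_pd oT a (sc i) iq Tt).
Qed.

Lemma covector_field_grad c : sring c -> covector_field (grad c).
Proof.
move=> rc; split=> [i a|X [_ cX _] i|X vX].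
- exact: (smooth_in_chart_pd oT a (rc.1 i)).
- exact: (cX _ rc.1).
- exact: scalar_ring_lie.
Qed.

Lemma lie_t_contract w X al i : covector_field w -> vector_field X ->
  eq_on T i (lie_t_scalar al (contract w X))
    (fun q t => pairing i (coautobracket w al) X q t
                + contract w (autobracket X al) q t).
Proof.
move=> [sw cw rw] vX q t iq Tt; have [sX _ _] := vX.
rewrite (lie_t_pairing al sw sX (rw X vX).1 (cw X vX i) iq Tt).
by rewrite (cw _ (vector_field_autobracket al vX) i q t iq Tt).
Qed.

(** The same device as for autobrackets: the Leibniz rule writes the pairing with [X] as a
    difference of two chart-free members of the ring. *)
Lemma covector_field_coautobracket w al :
  covector_field w -> covector_field (coautobracket w al).
Proof.
move=> cfw; have [sw cw rw] := cfw.
have E X i q t : vector_field X -> dom i q -> T t ->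
    pairing i (coautobracket w al) X q t =
    lie_t_scalar al (contract w X) q t - contract w (autobracket X al) q t.
  by move=> vX iq Tt; rewrite (lie_t_contract al cfw vX iq Tt) addrK.
split=> [i a|X vX i q t iq Tt|X vX].
- exact: smooth_coautobracket.
- by rewrite E// -(E X _ q t vX (chart_atP q)).
- have vXal := vector_field_autobracket al vX.
  apply: eq_scalar_ring (scalar_ringB (scalar_ring_lie_t al (rw X vX)) (rw _ vXal)).
  by move=> q t Tt; rewrite -(E X _ q t vX (chart_atP q) Tt).
Qed.

Lemma contract_coautobracket w X al q t : covector_field w -> vector_field X -> T t ->
  contract (coautobracket w al) X q t =
  lie_t_scalar al (contract w X) q t - contract w (autobracket X al) q t.
Proof.
move=> cfw vX Tt.
by rewrite (lie_t_contract al cfw vX (chart_atP q) Tt) addrK.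
Qed.

(** * Autobrackets and Lie derivatives of linear combinations *)

Lemma autobracket_comb (I : finType) (c : I -> scalar_field M) (X : I -> tensor_field M)
    (v : tensor_field M) al i :
    (forall k, sring (c k)) -> (forall k i a, smooth_in_chart T i (X k i a)) ->
    (forall a, eq_on T i (v i a) (fun q t => \sum_k c k q t * X k i a q t)) ->
  forall a, eq_on T i (autobracket v al i a) (fun q t =>
    \sum_k (c k q t * autobracket (X k) al i a q t
            + lie_t_scalar al (c k) q t * X k i a q t)).
Proof.
move=> rc sX vE a q t iq Tt.
have bE be : bracket (g be) v i a q t = \sum_k (c k q t * bracket (g be) (X k) i a q t
    + lie_scalar (g be) (c k) q t * X k i a q t).
  rewrite (@eq_bracket _ _ _ _ oT i _ v
    (fun i a q t => \sum_k c k q t * X k i a q t) a vE q t iq Tt).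
  rewrite (@bracket_sum _ _ _ _ oT i I (g be)
    (fun k i a q t => c k q t * X k i a q t)) //; last first.
    by move=> k b; apply: (smooth_in_chartM oT) => //; exact: (rc k).1.
  apply: eq_bigr => k _; rewrite (bracketM _ _ ((rc k).1 i) (sX k i) iq Tt).
  by have [_ cg _] := vector_field_g be; rewrite -(cg _ (rc k).1 i q t iq Tt).
have tE : dt (v i a) q t = \sum_k (c k q t * dt (X k i a) q t
    + dt (c k) q t * X k i a q t).
  rewrite (eq_dt oT (vE a) iq Tt).
  rewrite (@dt_sum _ _ _ _ oT i I (fun k q t => c k q t * X k i a q t)) //; last first.
    by move=> k; apply: (smooth_in_chartM oT) => //; exact: (rc k).1.
  by apply: eq_bigr => k _; rewrite (dtM ((rc k).1 i) (sX k i a) iq Tt) addrC.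
rewrite /autobracket.
under eq_bigr do rewrite bE mulr_sumr.
rewrite exchange_big /=.
under [RHS]eq_bigr do rewrite /lie_t_scalar lie_scalar_ghat mulrDr mulrDl addrACA.
rewrite big_split /=; congr (_ + _).
  apply: eq_bigr => k _; rewrite mulr_sumr mulr_suml -big_split.
  by apply: eq_bigr => be _ /=; ring.
case: eqP => _; first by rewrite /dtF tE.
by rewrite big1// => k _; rewrite mulr0 mul0r addr0.
Qed.

Lemma lie_t_comb (I : finType) (c : I -> scalar_field M) (w : I -> tensor_field M)
    (v : tensor_field M) be i :
    (forall k, sring (c k)) -> (forall k i a, smooth_in_chart T i (w k i a)) ->
    (forall a, eq_on T i (v i a) (fun q t => \sum_k c k q t * w k i a q t)) ->
  forall a, eq_on T i (lie_t g be v i a) (fun q t =>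
    \sum_k (c k q t * lie_t g be (w k) i a q t
            + (lie_scalar (g be) (c k) q t + (if be == ord0 then dt (c k) q t else 0))
              * w k i a q t)).
Proof.
move=> rc sw vE a q t iq Tt.
have bE : lie_covector (g be) v i a q t =
    \sum_k (c k q t * lie_covector (g be) (w k) i a q t
    + lie_scalar (g be) (c k) q t * w k i a q t).
  rewrite (@eq_lie_covector _ _ _ _ oT i _ v
    (fun i a q t => \sum_k c k q t * w k i a q t) a vE q t iq Tt).
  rewrite (@lie_covector_sum _ _ _ _ oT i I (g be)
    (fun k i a q t => c k q t * w k i a q t)) //; last first.
    by move=> k b; apply: (smooth_in_chartM oT) => //; exact: (rc k).1.
  apply: eq_bigr => k _; rewrite (lie_covectorM _ _ ((rc k).1 i) (sw k i) iq Tt).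
  by have [_ cg _] := vector_field_g be; rewrite -(cg _ (rc k).1 i q t iq Tt).
have tE : dt (v i a) q t = \sum_k (c k q t * dt (w k i a) q t
    + dt (c k) q t * w k i a q t).
  rewrite (eq_dt oT (vE a) iq Tt).
  rewrite (@dt_sum _ _ _ _ oT i I (fun k q t => c k q t * w k i a q t)) //; last first.
    by move=> k; apply: (smooth_in_chartM oT) => //; exact: (rc k).1.
  by apply: eq_bigr => k _; rewrite (dtM ((rc k).1 i) (sw k i a) iq Tt) addrC.
rewrite /lie_t bE.
under [RHS]eq_bigr do rewrite mulrDr mulrDl addrACA.
rewrite [RHS]big_split /=; congr (_ + _).
case: eqP => _; first by rewrite /dtF tE.
by rewrite big1// => k _; rewrite mulr0 mul0r addr0.
Qed.

(** The time derivative in [lie_t g ord0] gets the weight [nu al ord0], which is 1 for [al = ord0]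
    and 0 otherwise. *)
Lemma coautobracket_lie_t w al i a q t : T t ->
  coautobracket w al i a q t = \sum_be nu_mx q t al be * lie_t g be w i a q t.
Proof.
move=> Tt; rewrite /lie_t /coautobracket.
under [RHS]eq_bigr do rewrite mulrDr.
rewrite big_split /=; congr (_ + _).
rewrite (bigD1 ord0)//= nu_mx_col0// big1 ?addr0; last first.
  by move=> be /negbTE ->; rewrite mulr0.
by case: eqP; rewrite ?mul1r ?mul0r.
Qed.

(** Inverts the preceding relation by [mu]: over the ring of coefficients the two families of
    operators generate the same fields. *)
Lemma lie_t_coautobracket w be i a q t : T t ->
  lie_t g be w i a q t = \sum_al mu_mx q t be al * coautobracket w al i a q t.
Proof.
move=> Tt; under eq_bigr do rewrite coautobracket_lie_t// mulr_sumr.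
rewrite exchange_big /= (bigD1 be)//= [X in _ = _ + X]big1 ?addr0.
  under eq_bigr do rewrite mulrA.
  by rewrite -mulr_suml mu_nu_mx// eqxx mul1r.
move=> k kbe; under eq_bigr do rewrite mulrA.
by rewrite -mulr_suml mu_nu_mx// eq_sym (negbTE kbe) mul0r.
Qed.

(** * Codistributions *)

(** The last clause closes [H] under equality where components have a meaning, the equality used in
    [span]. *)
Definition submodule (H : set (tensor_field M)) : Prop :=
  [/\ H (fun _ _ _ _ => 0),
      forall v w, H v -> H w -> H (fun i a q t => v i a q t + w i a q t),
      forall c v, sring c -> H v -> H (fun i a q t => c q t * v i a q t) &
      forall v w, (forall i a, eq_on T i (v i a) (w i a)) -> H v -> H w].

Lemma submodule_comb H (I : finType) (c : I -> scalar_field M)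
    (v : I -> tensor_field M) (w : tensor_field M) :
    submodule H -> (forall k, sring (c k)) -> (forall k, H (v k)) ->
    (forall i a, eq_on T i (w i a) (fun q t => \sum_k c k q t * v k i a q t)) ->
  H w.
Proof.
move=> [H0 HD HZ Heq] rc Hv wE.
apply: (Heq (fun i a q t => \sum_k c k q t * v k i a q t)).
  by move=> i a q t iq Tt; rewrite (wE i a q t iq Tt).
elim: (index_enum I) => [|k s IH].
  by apply: Heq H0 => i a q t _ _; rewrite big_nil.
apply: Heq (HD _ _ (HZ _ _ (rc k) (Hv k)) IH) => i a q t _ _.
by rewrite big_cons.
Qed.

Lemma submoduleB H v w : submodule H -> H v -> H w ->
  H (fun i a q t => v i a q t - w i a q t).
Proof.
move=> [_ HD HZ Heq] Hv Hw.
apply: Heq (HD _ _ Hv (HZ _ _ (scalar_ring_cst (-1)) Hw)) => i a q t _ _ /=.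
by rewrite mulN1r.
Qed.

Lemma sub_span G : G `<=` span Sys G.
Proof.
move=> w Gw; exists 1, (fun _ _ _ => 1), (fun=> w); split => //.
  by move=> _; exact: scalar_ring_cst.
by move=> i a q t _ _; rewrite big_ord_recl big_ord0 mul1r addr0.
Qed.

Lemma span_submodule G : submodule (span Sys G).
Proof.
split.
- exists 0%N, (fun _ _ _ => 0), (fun _ _ _ _ _ => 0); split => [[]//|[]//|].
  by move=> i a q t _ _; rewrite big_ord0.
- move=> v w [m1 [c1 [v1 [rc1 Gv1 E1]]]] [m2 [c2 [v2 [rc2 Gv2 E2]]]].
  exists (m1 + m2)%N,
    (fun k => match fintype.split k with inl k => c1 k | inr k => c2 k end),
    (fun k => match fintype.split k with inl k => v1 k | inr k => v2 k end); split.
  + by move=> k; case: fintype.split.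
  + by move=> k; case: fintype.split.
  + move=> i a q t iq Tt; rewrite E1// E2// big_split_ord /=.
    congr (_ + _); apply: eq_bigr => k _.
      by rewrite (unsplitK (inl k)).
    by rewrite (unsplitK (inr k)).
- move=> c v rc [m [c1 [v1 [rc1 Gv1 E1]]]].
  exists m, (fun k q t => c q t * c1 k q t), v1; split => //.
    by move=> k; exact: scalar_ringM.
  move=> i a q t iq Tt; rewrite E1// mulr_sumr.
  by apply: eq_bigr => k _; rewrite mulrA.
- move=> v w vw [m [c1 [v1 [rc1 Gv1 E1]]]].
  exists m, c1, v1; split => // i a q t iq Tt.
  by rewrite -(vw i a q t iq Tt) E1.
Qed.

Lemma span_min G H : submodule H -> G `<=` H -> span Sys G `<=` H.
Proof.
move=> mH GH w [m [c [v [rc Gv E]]]].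
exact: (submodule_comb (v := v) mH rc (fun k => GH _ (Gv k))).
Qed.

Local Notation Omega_g := (Omega_g Sys sel).
Local Notation Delta := (Delta Sys sel).

(** * Words of autobrackets as generators of [Delta] and [Omega_g] *)

Definition coautobrackets w (als : seq 'I_m_w.+1) : tensor_field M :=
  foldl coautobracket w als.

Lemma vector_field_autobrackets X als :
  vector_field X -> vector_field (autobrackets X als).
Proof.
elim: als X => //= al als IH X vX; apply: IH; exact: vector_field_autobracket.
Qed.

Lemma covector_field_coautobrackets w als :
  covector_field w -> covector_field (coautobrackets w als).
Proof.
elim: als w => //= al als IH w cw; apply: IH; exact: covector_field_coautobracket.
Qed.

Lemma autobrackets_rcons X als al :
  autobrackets X (rcons als al) = autobracket (autobrackets X als) al.
Proof. by rewrite /Defs.autobrackets foldl_rcons. Qed.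

Lemma coautobrackets_rcons w als al :
  coautobrackets w (rcons als al) = coautobracket (coautobrackets w als) al.
Proof. by rewrite /coautobrackets foldl_rcons. Qed.

Definition autobracket_gens k : set (tensor_field M) :=
  [set X | exists i als, (size als <= k)%N /\ X = autobrackets (f i) als].

Definition coautobracket_gens k : set (tensor_field M) :=
  [set w | exists j als, (size als <= k)%N /\ w = coautobrackets (grad (htilde j)) als].

(** An autobracket lengthens words by one letter; by the Leibniz rule, the derivatives of the
    coefficients multiply only the old words. *)
Lemma Delta_sub k : Delta k `<=` span Sys (autobracket_gens k).
Proof.
elim: k => [|k IH].
  apply: span_min; first exact: span_submodule.
  by move=> _ [i _ <-]; apply: sub_span; exists i, [::].
have gensS : span Sys (autobracket_gens k) `<=` span Sys (autobracket_gens k.+1).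
  apply: span_min; first exact: span_submodule.
  move=> _ [i [als [sz ->]]]; apply: sub_span; exists i, als; split => //.
  exact: leqW.
apply: span_min; first exact: span_submodule.
move=> w [/IH/gensS//|[be _]].
apply: span_min w; first exact: span_submodule.
move=> _ [v /IH[m [c [X [rc GX E]]]] <-].
have sX k' i a : smooth_in_chart T i (X k' i a).
  have [j [als [_ ->]]] := GX k'.
  by have [] := vector_field_autobrackets als (vector_field_f j).
have [_ HD _ Heq] := span_submodule (autobracket_gens k.+1).
apply: Heq; last apply: (HD
    (fun i a q t => \sum_k c k q t * autobracket (X k) be i a q t)
    (fun i a q t => \sum_k lie_t_scalar be (c k) q t * X k i a q t)).
- move=> i a q t iq Tt; rewrite (autobracket_comb be rc sX (E i) a iq Tt).
  by rewrite big_split.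
- apply: (submodule_comb (v := fun k => autobracket (X k) be)
            (span_submodule _) rc) => // k'.
  have [j [als [sz ->]]] := GX k'; apply: sub_span.
  by exists j, (rcons als be); rewrite size_rcons autobrackets_rcons.
- apply: (submodule_comb (v := X) (c := fun k => lie_t_scalar be (c k))
            (span_submodule _)) => // k'; first exact: scalar_ring_lie_t.
  by apply: gensS; exact: sub_span.
Qed.

(** As for [Delta], except that the recursion uses [lie_t g], which [mu] rewrites in terms of
    coautobrackets. *)
Lemma Omega_g_sub k : Omega_g k `<=` span Sys (coautobracket_gens k).
Proof.
elim: k => [|k IH].
  apply: span_min; first exact: span_submodule.
  by move=> _ [i _ <-]; apply: sub_span; exists i, [::].
have gensS : span Sys (coautobracket_gens k) `<=` span Sys (coautobracket_gens k.+1).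
  apply: span_min; first exact: span_submodule.
  move=> _ [i [als [sz ->]]]; apply: sub_span; exists i, als; split => //.
  exact: leqW.
apply: span_min; first exact: span_submodule.
move=> w [/IH/gensS//|[be _]].
apply: span_min w; first exact: span_submodule.
move=> _ [v /IH[m [c [X [rc GX E]]]] <-].
have sX k' i a : smooth_in_chart T i (X k' i a).
  have [j [als [_ ->]]] := GX k'.
  by have [] := covector_field_coautobrackets als
                  (covector_field_grad (scalar_ring_htilde j)).
have [_ HD _ Heq] := span_submodule (coautobracket_gens k.+1).
pose lc k := fun q t => lie_scalar (g be) (c k) q t
                        + (if be == ord0 then dt (c k) q t else 0).
have rlc k' : sring (lc k').
  apply: scalar_ringD; first exact: (scalar_ring_lie (vector_field_g be)).
  by case: eqP => _; [exact: scalar_ring_dt|exact: scalar_ring_cst].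
apply: Heq; last apply: (HD
    (fun i a q t => \sum_k c k q t * lie_t g be (X k) i a q t)
    (fun i a q t => \sum_k lc k q t * X k i a q t)).
- move=> i a q t iq Tt; rewrite (lie_t_comb be rc sX (E i) a iq Tt).
  by rewrite big_split.
- apply: (submodule_comb (v := fun k => lie_t g be (X k))
            (span_submodule _) rc) => // k'.
  apply: (submodule_comb (v := coautobracket (X k')) (span_submodule _)
            (scalar_ring_mu be)); last first.
    by move=> i a q t iq Tt; exact: lie_t_coautobracket.
  move=> al; have [j [als [sz ->]]] := GX k'; apply: sub_span.
  by exists j, (rcons als al); rewrite size_rcons coautobrackets_rcons.
- apply: (submodule_comb (v := X) (span_submodule _) rlc) => // k'.
  by apply: gensS; exact: sub_span.
Qed.

Lemma Delta_le k : Delta 0 `<=` Delta k.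
Proof.
by elim: k => [//|k IH] w /IH Dw; apply: sub_span; left.
Qed.

(** A stationary [Delta r] is closed under autobrackets, so words of any length stay in it. *)
Lemma autobrackets_Delta r i als : Delta r.+1 = Delta r ->
  Delta r (autobrackets (f i) als).
Proof.
move=> hr; elim/last_ind: als => [|als al IH].
  by apply: (@Delta_le r); apply: sub_span; exists i.
rewrite -hr autobrackets_rcons; apply: sub_span; right; exists al => //.
by apply: sub_span; exists (autobrackets (f i) als).
Qed.

Lemma coautobrackets_Omega_g j als :
  Omega_g (size als) (coautobrackets (grad (htilde j)) als).
Proof.
elim/last_ind: als => [|als al IH]; first by apply: sub_span; exists j.
rewrite size_rcons coautobrackets_rcons.
apply: (submodule_comb (c := fun be q t => nu_mx q t al be)
   (v := fun be => lie_t g be (coautobrackets (grad (htilde j)) als))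
   (span_submodule _)).
- by move=> be; exact: scalar_ring_nu.
- move=> be; apply: sub_span; right; exists be => //; apply: sub_span.
  by exists (coautobrackets (grad (htilde j)) als).
- by move=> i a q t _ Tt; exact: coautobracket_lie_t.
Qed.

(** * Differentials of the functions y_(a,b) in an invariant codistribution *)

Section Invariant.
Variable O : set (tensor_field M).
Hypothesis mO : submodule O.
Hypothesis lieO : forall be w, O w -> O (lie_t ghat be w).

Lemma eq_grad_mem c d : (forall q t, T t -> c q t = d q t) -> O (grad c) -> O (grad d).
Proof.
move=> cd; have [_ _ _ Oeq] := mO; apply: Oeq => i a.
by apply: (eq_pd oT) => q t _; exact: cd.
Qed.

Lemma gradB_mem c d : smooth_scalar T c -> smooth_scalar T d ->
  O (grad c) -> O (grad d) -> O (grad (fun q t => c q t - d q t)).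
Proof.
move=> sc sd Oc Od; have [_ _ _ Oeq] := mO.
apply: Oeq (submoduleB mO Oc Od) => i a q t iq Tt; rewrite /grad.
rewrite (pdD a (c := c) (d := fun q t => - d q t) (sc i) _ iq Tt); last first.
  exact: (smooth_in_chartN oT (sd i)).
by rewrite (pdN a (sd i) iq Tt).
Qed.

Lemma grad_lie_t_mem al c : sring c -> O (grad c) -> O (grad (lie_t_scalar al c)).
Proof.
move=> rc /(lieO al); have [_ _ _ Oeq] := mO; apply: Oeq => i a.
exact: lie_t_ghat_grad.
Qed.

Local Notation om j a := (coautobrackets (grad (htilde j)) a).
Local Notation phi i b := (autobrackets (f i) b).
Local Notation y j a i b := (contract (om j a) (phi i b)).

Let cov j a : covector_field (om j a).
Proof.
exact: covector_field_coautobrackets (covector_field_grad (scalar_ring_htilde j)).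
Qed.

Let vec i b : vector_field (phi i b).
Proof. exact: vector_field_autobrackets (vector_field_f i). Qed.

Let ry j a i b : sring (y j a i b).
Proof. by have [_ _] := cov j a; apply; exact: vec. Qed.

Lemma contract_coautobrackets_rcons j a al i b q t : T t ->
  y j (rcons a al) i b q t =
  lie_t_scalar al (y j a i b) q t - y j a i (rcons b al) q t.
Proof.
move=> Tt; rewrite coautobrackets_rcons autobrackets_rcons.
by rewrite contract_coautobracket.
Qed.

Lemma contract_autobrackets_rcons j a al i b q t : T t ->
  y j a i (rcons b al) q t =
  lie_t_scalar al (y j a i b) q t - y j (rcons a al) i b q t.
Proof. by move=> Tt; rewrite contract_coautobrackets_rcons// opprB addrC subrK. Qed.

Variables s r : nat.
Hypothesis s_gt0 : (0 < s)%N.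
Hypothesis hs : Omega_g s = Omega_g s.-1.
Hypothesis hr : Delta r.+1 = Delta r.
Hypothesis hO : forall j i b, (size b <= s + r)%N -> O (grad (y j [::] i b)).

(** Moving the last letter of [a] to the end of [b] keeps the total length, and the other term, D^al
    y_(a,b), has a smaller one; the descent on [a] ends at the empty word, where [hO] applies. *)
Lemma grad_contract_mem_short j a i b : (size a + size b <= s + r)%N ->
  O (grad (y j a i b)).
Proof.
elim/last_ind: a b => [|a al IH] b sz; first exact: hO.
rewrite size_rcons addSn in sz.
apply: eq_grad_mem (gradB_mem (scalar_ring_lie_t al (ry j a i b)).1
  (ry j a i (rcons b al)).1 _ _).
- by move=> q t Tt; rewrite contract_coautobrackets_rcons.
- by apply: grad_lie_t_mem => //; apply: IH; exact: ltnW.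
- by apply: IH; rewrite size_rcons addnS.
Qed.

(* Differentiating [om j a = \sum_k c k * om (jk k) (ak k)] against [phi i b]: the
   terms with the differentials of the coefficients [c k] lie in [O] for short
   words [b], hence, being linear in [phi i b], for all words. *)
Lemma grad_contract_mem_closing j a : size a = s -> forall i b,
    (forall j' a', (size a' < s)%N -> O (grad (y j' a' i b))) ->
  O (grad (y j a i b)).
Proof.
move=> sza.
(* A word of length [s] lies in [Omega_g s], which is [Omega_g s.-1]; hence the combination [E] of
   words of length at most [s.-1]. *)
have : Omega_g s.-1 (om j a) by rewrite -hs -sza; exact: coautobrackets_Omega_g.
move=> /Omega_g_sub[m [c [w [rc Gw E]]]].
have cw k : covector_field (w k) by have [j' [a' [_ ->]]] := Gw k; exact: cov.
have rw X k : vector_field X -> sring (contract (w k) X).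
  by have [_ _] := cw k; apply.
pose rest X : tensor_field M := fun i a q t =>
  \sum_k contract (w k) X q t * grad (c k) i a q t.
have gradE X : vector_field X -> forall i a', eq_on T i
    (grad (contract (om j a) X) i a')
    (fun q t => rest X i a' q t + \sum_k c k q t * grad (contract (w k) X) i a' q t).
  move=> vX i a' q t iq Tt.
  have sc k : smooth_in_chart T i (c k) by exact: (rc k).1.
  have sw k : smooth_in_chart T i (contract (w k) X) by exact: (rw X k vX).1.
  rewrite /rest /grad -big_split /=.
  rewrite (@eq_pd _ _ _ _ oT i a' _
    (fun q t => \sum_k c k q t * contract (w k) X q t) _ q t iq Tt).
    rewrite (@pd_sum _ _ _ _ oT i a' _
      (fun k q t => c k q t * contract (w k) X q t) _ _ _ iq Tt).
      by apply: eq_bigr => k _; rewrite (pdM a' (sc k) (sw k) iq Tt) mulrC.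
    by move=> k; exact: (smooth_in_chartM oT).
  move=> q' t' iq' Tt'; rewrite /contract.
  under [RHS]eq_bigr do rewrite mulr_sumr.
  rewrite exchange_big; apply: eq_bigr => b _ /=.
  rewrite (E _ _ _ _ (chart_atP q') Tt') mulr_suml.
  by apply: eq_bigr => k _; rewrite mulrA.
have [_ OD _ Oeq] := mO.
have wy X : (forall k, O (grad (contract (w k) X))) ->
    O (fun i a q t => \sum_k c k q t * grad (contract (w k) X) i a q t).
  by move=> Ow; exact: (submodule_comb (c := c)
       (v := fun k => grad (contract (w k) X)) mO).
(* The bound on [b] leaves room for the [s] letters of [a]: every contraction in [gradE] has total
   length at most [s + r], so its differential is in [O], and so is the remainder. *)
have rest_small i b : (size b <= r)%N -> O (rest (phi i b)).
  move=> szb.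
  have Oy : O (grad (y j a i b)) by apply: grad_contract_mem_short; rewrite sza leq_add2l.
  apply: Oeq (submoduleB mO Oy (wy (phi i b) _)) => [i' a' q t iq Tt|k].
    by rewrite (gradE _ (vec i b) _ _ q t iq Tt) addrK.
  have [j' [a' [sza' ->]]] := Gw k; apply: grad_contract_mem_short.
  by apply: leq_add => //; apply: leq_trans sza' (leq_pred s).
(* [rest] involves no derivative of its argument, so it is linear over the scalars, and stationarity
   of [Delta] reduces every word to words of length at most [r]. *)
have rest_all i b : O (rest (phi i b)).
  have [m' [d [X [rd GX EX]]]] := Delta_sub (autobrackets_Delta i b hr).
  apply: (submodule_comb (c := d) (v := fun l => rest (X l)) mO rd) => [l|i' a' q t iq Tt].
    by have [i' [b' [szb' ->]]] := GX l; exact: rest_small.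
  rewrite /rest; under [RHS]eq_bigr do rewrite mulr_sumr.
  rewrite exchange_big; apply: eq_bigr => k _ /=.
  under eq_bigr do rewrite mulrA.
  rewrite -mulr_suml; congr (_ * _); rewrite /contract.
  under [RHS]eq_bigr do rewrite mulr_sumr.
  rewrite exchange_big; apply: eq_bigr => b' _ /=.
  rewrite (EX _ _ _ _ (chart_atP q) Tt) mulr_sumr.
  by apply: eq_bigr => l _; rewrite mulrCA.
move=> i b Oy; apply: Oeq (OD _ _ (rest_all i b) (wy (phi i b) _)) => [i' a' q t iq Tt|k].
  by rewrite (gradE _ (vec i b) _ _ q t iq Tt).
have [j' [a' [sza' ->]]] := Gw k; apply: Oy.
by rewrite -(prednK s_gt0) ltnS.
Qed.

(** Induction on [b] for all [a] shorter than [s] at once: the new letter of [b] is traded for one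
    appended to [a], and if [a] thereby reaches length [s], the closing relation leads back to
    shorter words with the same [b]. *)
Lemma grad_contract_mem j a i b : (size a < s)%N -> O (grad (y j a i b)).
Proof.
elim/last_ind: b j a => [|b al IH] j a sza.
  by apply: grad_contract_mem_short; rewrite addn0 (leq_trans (ltnW sza))// leq_addr.
apply: eq_grad_mem (gradB_mem (scalar_ring_lie_t al (ry j a i b)).1
  (ry j (rcons a al) i b).1 _ _).
- by move=> q t Tt; rewrite contract_autobrackets_rcons.
- by apply: grad_lie_t_mem => //; exact: IH.
- move: sza; rewrite leq_eqVlt => /orP[/eqP sza|sza].
    by apply: grad_contract_mem_closing => //; rewrite size_rcons.
  by apply: IH; rewrite size_rcons.
Qed.

End Invariant.

(** * Comparison of the recursions for [O] and [Omega] *)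

Local Notation Omega := (Omega Sys sel).
Local Notation O_seq := (O_seq Sys sel).

Lemma Omega_le k l : (k <= l)%N -> Omega k `<=` Omega l.
Proof.
move=> /subnKC <-; elim: (l - k)%N => [|m IH] w Ow; first by rewrite addn0.
by rewrite addnS; apply: sub_span; left; left; left; exact: IH.
Qed.

Lemma Omega_submodule k : submodule (Omega k).
Proof. by case: k => [|k]; exact: span_submodule. Qed.

Lemma O_seq_submodule s r k : submodule (O_seq s r k).
Proof. by case: k => [|k]; exact: span_submodule. Qed.

Lemma O_seq_le s r k : O_seq s r 0 `<=` O_seq s r k.
Proof. by elim: k => [//|k IH] w /IH Ow; apply: sub_span; left; left. Qed.

(** A generator with a word of length [l] enters [Omega] at index [l.+1], and the words in [O_tilde]
    have length at most [s + r]. *)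
Lemma O_seq0_Omega s r : O_seq s r 0 `<=` Omega (s + r).+1.
Proof.
apply: span_min (Omega_submodule _) _ => w [].
  apply: span_min w; first exact: Omega_submodule.
  move=> _ [j [als [i [sz ->]]]].
  apply: (@Omega_le (size als).+1) => //.
  have vX := vector_field_autobrackets als (vector_field_f i).
  have [_ _ _ Oeq] := Omega_submodule (size als).+1.
  apply: (Oeq (lie_covector (autobrackets (f i) als) (grad (htilde j)))).
    by move=> i' a; apply: lie_covector_grad => //; exact: (scalar_ring_htilde j).1.
  by apply: sub_span; right; apply: sub_span; exists j, als, i.
exact: (@Omega_le 0).
Qed.

(** Both recursions apply the same Lie derivatives, so one step of [O_seq] costs one step of
    [Omega]. *)
Lemma O_seq_Omega s r k : O_seq s r k `<=` Omega ((s + r).+1 + k).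
Proof.
elim: k => [|k IH]; first by rewrite addn0; exact: O_seq0_Omega.
rewrite addnS; apply: span_min; first exact: span_submodule.
move=> w [[/IH Ow|[i _]]|[be _]]; first by apply: sub_span; left; left; left.
- apply: span_min w; first exact: span_submodule.
  move=> _ [w /IH Ow <-]; apply: sub_span; left; left; right.
  by exists i => //; apply: sub_span; exists w.
- apply: span_min w; first exact: span_submodule.
  move=> _ [w /IH Ow <-]; apply: sub_span; left; right.
  by exists be => //; apply: sub_span; exists w.
Qed.

Lemma Omega_O_seq s r k l : (0 < s)%N -> Omega_g s = Omega_g s.-1 ->
    Delta r.+1 = Delta r -> (0 < k)%N -> O_seq s r k = O_seq s r k.-1 ->
  Omega l `<=` O_seq s r k.
Proof.
move=> s_gt0 hs hr k_gt0 hk.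
(* Each step depends only on the preceding codistribution, so stationarity passes to the next index;
   this gives stability under all the derivations. *)
have hkS : O_seq s r k.+1 = O_seq s r k.
  by case: k k_gt0 hk => // k _ /= hk; rewrite [in LHS]hk.
have mO := O_seq_submodule s r k.
have lieO be w : O_seq s r k w -> O_seq s r k (lie_t ghat be w).
  move=> Ow; rewrite -hkS; apply: sub_span; right; exists be => //.
  by apply: sub_span; exists w.
have lief i w : O_seq s r k w -> O_seq s r k (lie_covector (f i) w).
  move=> Ow; rewrite -hkS; apply: sub_span; left; right; exists i => //.
  by apply: sub_span; exists w.
elim: l => [|l IH].
  by move=> w Ow; apply: O_seq_le; apply: sub_span; right.
apply: span_min => // w [[[/IH//|[i _]]|[be _]]|].
- by apply: span_min w => // _ [w /IH Ow <-]; exact: lief.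
- by apply: span_min w => // _ [w /IH Ow <-]; exact: lieO.
apply: span_min w => // _ [j [als [i [_ ->]]]].
have vX := vector_field_autobrackets als (vector_field_f i).
have [_ _ _ Oeq] := mO.
apply: (Oeq (grad (lie_scalar (autobrackets (f i) als) (htilde j)))).
  move=> i' a q t iq Tt.
  by rewrite (lie_covector_grad a vX (scalar_ring_htilde j).1 iq Tt).
(* With [a] empty the contraction is by definition the Lie derivative of [htilde j]; [O_tilde]
   supplies the words of length at most [s + r]. *)
apply: (@grad_contract_mem _ mO lieO s r s_gt0 hs hr _ j [::] i als) => // j' i' b szb.
apply: O_seq_le; apply: sub_span; left; apply: sub_span.
by exists j', b, i'.
Qed.

End System.

Theorem theorem4p1 (R : realType) (n m_u m_w p : nat) (M : smooth_manifold R n)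
    (Sys : input_output_system M m_u m_w p) (sel : 'I_m_w -> 'I_p)
    (hcan : canonical_form Sys sel)
    (s r : nat) (hs : is_s Sys sel s) (hr : is_r Sys sel r)
    (O : set (tensor_field M)) (hO : is_O Sys sel s r O) :
  (exists khat : nat, forall k : nat, (khat <= k)%N -> O `<=` Omega Sys sel k) /\
  (forall k : nat, Omega Sys sel k `<=` O).
Proof.
have [[s_gt0 hs'] _] := hs; have [hr' _] := hr; have [k [[k_gt0 hk] _] ->] := hO.
split=> [|l]; last exact: Omega_O_seq.
(* [(s + r).+1] steps absorb the initial codistribution, and [k] more the recursion up to its
   stationary index. *)
exists ((s + r).+1 + k)%N => l kl w Ow.
exact/(Omega_le kl)/(O_seq_Omega hcan).
Qed.
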